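(* Let $(\mathcal{S},\mathcal{A},P,r)$ be a weakly communicating MDP with finite state space $\mathcal{S}$ ($S=|\mathcal{S}|$), finite action space $\mathcal{A}$ ($A=|\mathcal{A}|$), unknown transition kernel $P$ and known reward $r:\mathcal{S}\times\mathcal{A}\to[0,1]$. Fix $\delta\in(0,1)$ and a positive integer $n$, and run the following algorithm (Algorithm 1). For every $(s,a)$ draw $n$ i.i.d. samples $S^1_{s,a},\dots,S^n_{s,a}\sim P(\cdot\mid s,a)$ and set $\widehat P(s'\mid s,a)=\frac1n\sum_{i=1}^n\mathbb{I}\{S^i_{s,a}=s'\}$. Let $\mathcal{H}=\{\gamma:\ \tfrac{1}{1-\gamma}=2^k \text{ for some integer } k,\ \sqrt n\le \tfrac{1}{1-\gamma}\le n\}$. For each $\gamma\in\mathcal{H}$, let $(\widetilde\pi_\gamma,\widetilde V_\gamma)=\textsc{SolveDMDP}(\widehat P,r,\gamma,\tfrac1n)$ and $$\widehat L(\gamma)=(1-\gamma)\min_s\widetilde V_\gamma(s)-2\frac{1-\gamma}{n}-\alpha(\delta,n)\sqrt{\frac{\|\widetilde V_\gamma\|_{\mathrm{sp}}+\frac3n+1}{n}}.$$ Let $\widehat\gamma\in\arg\max_{\gamma\in\mathcal{H}}\widehat L(\gamma)$ and output $\widehat\pi=\widetilde\pi_{\widehat\gamma}$ and $\widehat\rho=\max\{\widehat L(\widehat\gamma),0\}\mathbf 1$. Then there is an absolute constant $C_3$ such that with probability at least $1-\delta$, elementwise, $$\rho^{\widehat\pi}\ \ge\ \widehat\rho\ \ge\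 \rho^\star-C_3\,\alpha(\delta,n)^2\sqrt{\frac{\|h^\star\|_{\mathrm{sp}}+1}{n}}\,\mathbf 1.$$
   Context: Policies are stationary Markovian $\pi:\mathcal{S}\to\Delta(\mathcal{A})$. For a transition kernel $Q$, discount $\gamma\in(0,1)$ and policy $\pi$, the discounted value is $V^\pi_\gamma(s)=\mathbb{E}^\pi_s[\sum_{t\ge0}\gamma^t r(S_t,A_t)]$; $\widehat V^\pi_\gamma,\widehat V^\star_\gamma$ denote the value of $\pi$ and optimal value in the DMDP $(\widehat P,r,\gamma)$. $\textsc{SolveDMDP}(\widehat P,r,\gamma,\frac1n)$ is any subroutine returning a deterministic policy $\widetilde\pi_\gamma$ and vector $\widetilde V_\gamma$ with $\widehat V^{\widetilde\pi_\gamma}_\gamma\ge\widehat V^\star_\gamma-\frac1n\mathbf 1$ and $\|\widetilde V_\gamma-\widehat V^\star_\gamma\|_\infty\le\frac1n$. The gain is $\rho^\pi(s)=\lim_{T\to\infty}\frac1T\mathbb{E}^\pi_s[\sum_{t=0}^{T-1}r(S_t,A_t)]$ and bias $h^\pi(s)=\mathrm{C}\text{-}\lim_{T\to\infty}\mathbb{E}^\pi_s[\sum_{t=0}^{T-1}(r(S_t,A_t)-\rho^\pi(S_t))]$ (Cesàro limit). $\rho^\star=\sup_\pi\rho^\pi$ (constant in weakly communicating MDPs), $h^\star=h^{\pi^\star}$ for a Blackwell-optimal policy $\pi^\star$ (one that is optimal in the $\gamma$-discounted problem for all $\gamma$ sufficiently close to 1). $\|x\|_{\mathrm{sp}}=\max_s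 x(s)-\min_s x(s)$. $\mathbf 1$ is the all-ones vector. $\alpha(\delta,n)=96\sqrt{\log(24SAn^5/\delta)}\,\log_2(\log_2(n+4))$. A weakly communicating MDP is one whose states split into a set transient under every stationary policy and a set in which every state can reach every other with probability 1 under some policy. *)

(* Defs.v *)
From HB Require Import structures.
From mathcomp Require Import all_boot all_order all_algebra.
From mathcomp Require Import all_classical all_reals all_analysis.
Set Implicit Arguments. Unset Strict Implicit. Unset Printing Implicit Defensive.
Import Order.TTheory GRing.Theory Num.Theory.
Import numFieldNormedType.Exports.
Local Open Scope classical_set_scope.
Local Open Scope ring_scope.

Section MDP.
Variables (R : realType) (S A : finType).

Definition is_kernel (P : S -> A -> S -> R) : Prop :=
  (forall s a s', 0 <= P s a s') /\ (forall s a, \sum_(s' : S) P s a s' = 1).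

Definition is_policy (pi : S -> A -> R) : Prop :=
  (forall s a, 0 <= pi s a) /\ (forall s, \sum_(a : A) pi s a = 1).

Definition det_policy (d : S -> A) : S -> A -> R :=
  fun s a => if a == d s then 1 else 0.

Definition step (P : S -> A -> S -> R) (pi : S -> A -> R) (f : S -> R) : S -> R :=
  fun s => \sum_(a : A) pi s a * \sum_(s' : S) P s a s' * f s'.

Definition rew_pi (r : S -> A -> R) (pi : S -> A -> R) : S -> R :=
  fun s => \sum_(a : A) pi s a * r s a.

(* E^pi_s [ r(S_t, A_t) ] *)
Definition exp_reward (P : S -> A -> S -> R) (r : S -> A -> R)
  (pi : S -> A -> R) (t : nat) : S -> R :=
  iter t (step P pi) (rew_pi r pi).

Definition disc_value (P : S -> A -> S -> R) (r : S -> A -> R)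
  (pi : S -> A -> R) (gamma : R) (s : S) : R :=
  limn (fun T : nat => \sum_(t < T) gamma ^+ t * exp_reward P r pi t s).

Definition opt_disc_value (P : S -> A -> S -> R) (r : S -> A -> R)
  (gamma : R) (s : S) : R :=
  sup [set disc_value P r pi gamma s | pi in is_policy].

Definition gain (P : S -> A -> S -> R) (r : S -> A -> R)
  (pi : S -> A -> R) (s : S) : R :=
  limn (fun T : nat => T%:R^-1 * \sum_(t < T) exp_reward P r pi t s).

(* Bias h^pi(s): Cesaro limit of the partial sums
   x_T = E^pi_s [ sum_{t<T} (r(S_t,A_t) - rho^pi(S_t)) ],
   i.e. lim_T (1/T) sum_{k=1}^T x_k. *)
Definition bias (P : S -> A -> S -> R) (r : S -> A -> R)
  (pi : S -> A -> R) (s : S) : R :=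
  let x := fun k : nat => \sum_(t < k)
      (exp_reward P r pi t s - iter t (step P pi) (gain P r pi) s) in
  limn (fun T : nat => T%:R^-1 * \sum_(k < T) x k.+1).

Definition opt_gain (P : S -> A -> S -> R) (r : S -> A -> R) (s : S) : R :=
  sup [set gain P r pi s | pi in is_policy].

Definition blackwell_optimal (P : S -> A -> S -> R) (r : S -> A -> R)
  (pi : S -> A -> R) : Prop :=
  is_policy pi /\
  exists g0 : R, g0 < 1 /\ forall gamma : R, g0 < gamma -> gamma < 1 ->
    forall pi' : S -> A -> R, is_policy pi' -> forall s : S,
      disc_value P r pi' gamma s <= disc_value P r pi gamma s.

(* hit T y x = P^pi_x ( exists 1 <= t <= T, S_t = y ). *)
Fixpoint hit (P : S -> A -> S -> R) (pi : S -> A -> R) (y : S) (T : nat)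
  : S -> R :=
  match T with
  | 0 => fun _ => 0
  | T'.+1 => fun x => \sum_(a : A) pi x a *
       \sum_(x' : S) P x a x' * (if x' == y then 1 else hit P pi y T' x')
  end.

Definition hit_prob (P : S -> A -> S -> R) (pi : S -> A -> R) (y x : S) : R :=
  limn (fun T : nat => hit P pi y T x).

Definition transient (P : S -> A -> S -> R) (pi : S -> A -> R) (s : S) : Prop :=
  hit_prob P pi s s < 1.

Definition weakly_communicating (P : S -> A -> S -> R) : Prop :=
  exists C : {set S},
    (forall s, s \notin C -> forall pi, is_policy pi -> transient P pi s) /\
    (forall s s', s \in C -> s' \in C -> s != s' ->
       exists pi, is_policy pi /\ hit_prob P pi s' s = 1).

Definition vmin (f : S -> R) : R := inf (range f).
Definition vmax (f : S -> R) : R := sup (range f).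
Definition spnorm (f : S -> R) : R := vmax f - vmin f.

(* Sample outcomes: omega (s, a, i) = S^i_{s,a}, i < n. *)
Definition outcome (n : nat) := {ffun (S * A * 'I_n) -> S}.

Definition outcome_mass (n : nat) (P : S -> A -> S -> R) (w : outcome n) : R :=
  \prod_(x : S * A * 'I_n) P x.1.1 x.1.2 (w x).

Definition prob (n : nat) (P : S -> A -> S -> R) (E : outcome n -> Prop) : R :=
  \sum_(w : outcome n | `[< E w >]) outcome_mass P w.

Definition Phat (n : nat) (w : outcome n) : S -> A -> S -> R :=
  fun s a s' => n%:R^-1 * #|[set i : 'I_n | w (s, a, i) == s']|%:R.


Definition log2 (x : R) : R := ln x / ln 2.

Definition alpha (delta : R) (n : nat) : R :=
  96 * Num.sqrt (ln (24 * #|S|%:R * #|A|%:R * (n%:R ^+ 5) / delta))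
     * log2 (log2 (n%:R + 4)).

Definition in_grid (n : nat) (gamma : R) : Prop :=
  exists k : nat, gamma = 1 - (2 ^+ k)^-1 /\
    Num.sqrt (n%:R : R) <= 2 ^+ k /\ (2 ^+ k : R) <= n%:R.

Definition solve_spec (n : nat) (Q : S -> A -> S -> R) (r : S -> A -> R)
  (gamma : R) (out : (S -> A) * (S -> R)) : Prop :=
  (forall s, opt_disc_value Q r gamma s - n%:R^-1
              <= disc_value Q r (det_policy out.1) gamma s) /\
  (forall s, `| out.2 s - opt_disc_value Q r gamma s | <= n%:R^-1).

Definition Lhat (delta : R) (n : nat) (gamma : R) (Vt : S -> R) : R :=
  (1 - gamma) * vmin Vt - 2 * (1 - gamma) / n%:R
  - alpha delta n * Num.sqrt ((spnorm Vt + 3 / n%:R + 1) / n%:R).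

End MDP.
Arguments Phat {R S A n} w _ _ _.
Arguments det_policy {R S A} d _ _.

(* Main.v *)
Require Import Defs.
From HB Require Import structures.
From mathcomp Require Import all_boot all_order all_algebra.
From mathcomp Require Import all_classical all_reals all_analysis.
From mathcomp Require Import ring lra zify.
Import Order.TTheory GRing.Theory Num.Theory.
Import numFieldNormedType.Exports.
Local Open Scope classical_set_scope.
Local Open Scope ring_scope.
Set Implicit Arguments. Unset Strict Implicit. Unset Printing Implicit Defensive.

(* Write Q for the empirical kernel, V for the optimal value of the empirical
   discounted MDP, and x = sqrt (L / n) * sqrt (sp V + 1), L being the logarithm
   inside alpha. Bernstein's inequality bounds (Q - P) V at a state-action pair by
   x plus a small multiple of the variance of V under P; V depends on the samples,
   so the inequality is applied to the value of the MDP where the state is made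
   absorbing with a value on a grid, which does not depend on them.

   Soundness: if W satisfies g <= r_pi + P_pi W - W then g <= rho^pi. Take for W the
   sum of V and a small multiple of (V - min V)^2: the drift of the square contains
   the variance of V, which pays for the variance term of the deviation, so that
   g = (1 - gamma) min V - 49 x is allowed.

   Optimality: for the Blackwell-optimal bias h, which solves the average-reward
   optimality equation, constants plus h -+ a multiple of (h - min h)^2 are super- and
   subsolutions of the empirical Bellman equation. Hence V is
   rho / (1 - gamma) up to O(x / (1 - gamma) + sp h), now with h in place of V in x,
   and the horizon 1 / (1 - gamma) of order sqrt (n (sp h + 1)) is good enough. *)

(** * Markov operators on a finite state space *)

(** Pointwise, the variance of V can be as large as (sp V)^2, and Bernstein used state by state
    would then cost sp V / sqrt n. Only its average along a trajectory is of order sp V + 1. The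
    quadratic terms record this average without trajectories: the drift of (V - min V)^2 is the
    variance up to a loss of order sp V + 1, because one step of the process lowers V by at most
    about 1. Weighting the square by sqrt (L / n) / sqrt (sp V + 1) turns that loss into a multiple
    of x. The argument needs x below an absolute constant; for larger x the claimed bounds are
    trivial, since gains lie in [0, 1]. Rounding the value of the absorbed state to a multiple of
    1/n moves V by at most 1/n, which is below L / n. The price is a union bound over states,
    actions, signs, discounts and roundings, whence the power of n inside the logarithm. Since it
    covers all discounts of the grid, the selected discount may depend on the samples. *)

Section LinearAlgebra.
Variables (F : fieldType) (V : vectType F).

(** The hypothesis says that kernel and image meet only in 0; by rank-nullity their sum is then the
    whole space. *)
Lemma ker_img_decomposition (phi : V -> V) : linear phi ->
  (forall v, phi (phi v) = 0 -> phi v = 0) ->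
  forall w, exists u v, phi u = 0 /\ w = u + phi v.
Proof.
move=> phil phi2 w.
pose L : {linear V -> V} := HB.pack phi (GRing.isLinear.Build F V V _ phi phil).
pose f := linfun L.
have fE x : f x = phi x by rewrite /f lfunE.
have dsj : (lker f :&: limg f)%VS = 0%VS.
  apply/eqP; rewrite -subv0; apply/subvP => x /memv_capP[].
  rewrite memv_ker => /eqP fx0 /memv_imgP[y _ xE].
  rewrite memv0 xE fE; apply/eqP/phi2.
  by rewrite -!fE -xE fx0.
have : w \in (lker f + limg f)%VS.
  suff -> : (lker f + limg f)%VS = fullv by exact: memvf.
  apply/eqP; rewrite eqEdim subvf /=.
  rewrite (dimv_disjoint_sum dsj) -(limg_ker_dim f fullv) capfv.
  by rewrite leqnn.
case/memv_addP => u uk [y /memv_imgP[v _ ->] ->].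
exists u, v; split; last by rewrite fE.
by apply/eqP; rewrite -fE -memv_ker.
Qed.

End LinearAlgebra.

Section MarkovOperators.
Variables (R : realType) (S : finType).
Implicit Types (T : (S -> R) -> S -> R) (f g : S -> R).

(** A stochastic matrix, seen as a positive linear operator fixing constants. One theory then serves
    the step of a policy, the average at a fixed action and all iterates. *)
Definition markov_op T : Prop :=
  [/\ forall k f g s, T (fun x => k * f x + g x) s = k * T f s + T g s,
      forall f g, (forall x, f x <= g x) -> forall s, T f s <= T g s
    & forall k s, T (fun=> k) s = k].

Lemma exists_argmax f (s0 : S) : exists s, forall x, f x <= f s.
Proof.
case: (@Order.TotalTheory.arg_maxP _ R S s0 xpredT f isT) => s _ Hs.
by exists s => x; exact: Hs.
Qed.

Lemma exists_argmin f (s0 : S) : exists s, forall x, f s <= f x.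
Proof.
case: (@Order.TotalTheory.arg_minP _ R S s0 xpredT f isT) => s _ Hs.
by exists s => x; exact: Hs.
Qed.

Lemma markov_ext T f g : f =1 g -> T f =1 T g.
Proof. by move=> fg; have -> : f = g by apply/funext. Qed.

Lemma markovD T f g : markov_op T ->
  forall s, T (fun x => f x + g x) s = T f s + T g s.
Proof.
case=> lin _ _ s; rewrite -[T f s]mul1r -lin.
by apply: markov_ext => x; rewrite mul1r.
Qed.

Lemma markovZ T k f : markov_op T -> forall s, T (fun x => k * f x) s = k * T f s.
Proof.
move=> mT s; case: (mT) => lin _ cst; rewrite -[RHS]addr0 -(cst 0 s) -lin.
by apply: markov_ext => x; rewrite addr0.
Qed.

Lemma markovB T f g : markov_op T ->
  forall s, T (fun x => f x - g x) s = T f s - T g s.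
Proof.
move=> mT s; rewrite -[- T g s]mulN1r -(@markovZ T (-1) g mT) -markovD //.
by apply: markov_ext => x; rewrite mulN1r.
Qed.

Lemma markov_le T f k : markov_op T -> (forall x, f x <= k) -> forall s, T f s <= k.
Proof. by case=> _ mon cst fk s; rewrite -[leRHS](cst k s); exact: mon. Qed.

Lemma markov_ge T f k : markov_op T -> (forall x, k <= f x) -> forall s, k <= T f s.
Proof. by case=> _ mon cst fk s; rewrite -[leLHS](cst k s); exact: mon. Qed.

Lemma markov_iter T t : markov_op T -> markov_op (iter t T).
Proof.
move=> mT; case: (mT) => lin mon cst; elim: t => [|t [IH1 IH2 IH3]] //.
split=> [k f g s|f g fg s|k s] /=.
- by rewrite -lin; apply: markov_ext => x; rewrite IH1.
- by apply: mon => x; exact: IH2.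
- by rewrite -[RHS](cst k s); apply: markov_ext => x; rewrite IH3.
Qed.

(** Maximum principle: at a maximum point [m] of [f], [T f m <= f m], so [(1 - gamma) * f m <= 0].
    All comparisons of discounted sub- and supersolutions rest on it. *)
Lemma markov_contraction T gamma f : markov_op T -> 0 <= gamma < 1 ->
  (forall s, f s <= gamma * T f s) -> forall s, f s <= 0.
Proof.
move=> mT /andP[g0 g1] fT s; have [m Hm] := exists_argmax f s.
apply: (le_trans (Hm s)).
have : f m <= gamma * f m.
  by apply: (le_trans (fT m)); apply: ler_wpM2l => //; exact: markov_le.
by nra.
Qed.

Lemma fun_bounded f : exists2 M, 0 <= M & forall x, `|f x| <= M.
Proof.
exists (\sum_x `|f x|); first exact: sumr_ge0.
by move=> x; rewrite (bigD1 x) //= lerDl sumr_ge0.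
Qed.

Lemma markov_norm T f M : markov_op T -> (forall x, `|f x| <= M) ->
  forall s, `|T f s| <= M.
Proof.
move=> mT fM s; rewrite ler_norml markov_ge ?markov_le // => x.
- by have := fM x; rewrite ler_norml => /andP[].
- by have := fM x; rewrite ler_norml => /andP[].
Qed.

Let V : vectType R := {ffun S -> R^o}.

(** Kernel-image splitting of [I - gamma T]. It serves twice: for [gamma < 1] the kernel is 0 and
    the resolvent exists; for [gamma = 1] the kernel consists of the invariant functions. *)
Lemma markov_decomposition T gamma (r : S -> R) : markov_op T ->
  (forall f, (forall s, (f s - gamma * T f s) - gamma * T (fun x => f x - gamma * T f x) s = 0) ->
     forall s, f s - gamma * T f s = 0) ->
  exists u v : S -> R, forall s, u s - gamma * T u s = 0 /\ r s = u s + (v s - gamma * T v s).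
Proof.
move=> mT H; pose phi (v : V) : V := [ffun s => v s - gamma * T v s].
have phil : linear phi.
  move=> k u v; apply/ffunP => s; rewrite !ffunE.
  have -> : T (k *: u + v) s = k * T u s + T v s.
    case: mT => lin _ _; rewrite -lin; apply: markov_ext => x.
    by rewrite !ffunE.
  by rewrite /GRing.scale /=; ring.
have phi2 v : phi (phi v) = 0 -> phi v = 0.
  move=> /ffunP E; apply/ffunP => s; rewrite !ffunE.
  apply: (H v) => x; have := E x; rewrite !ffunE => <-; congr (_ - _ * _).
  by apply: markov_ext => y; rewrite ffunE.
have [u [v [/ffunP u0 /ffunP rE]]] :=
  @ker_img_decomposition _ V phi phil phi2 [ffun s => r s].
exists u, v => s; split.
- by have := u0 s; rewrite !ffunE.
- by have := rE s; rewrite !ffunE.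
Qed.

Lemma markov_fixpoint T gamma (r : S -> R) : markov_op T -> 0 <= gamma < 1 ->
  exists v : S -> R, forall s, v s = r s + gamma * T v s.
Proof.
move=> mT hg.
have inj f : (forall s, f s - gamma * T f s = 0) -> forall s, f s = 0.
  move=> f0 s; apply/eqP; rewrite eq_le; apply/andP; split.
    by apply: (markov_contraction mT hg) => x; have := f0 x; lra.
  rewrite -oppr_le0; apply: (@markov_contraction _ _ (fun x => - f x) mT hg) => x.
  have -> : T (fun x => - f x) x = - T f x.
    rewrite -[RHS]mulN1r -(@markovZ T (-1) f mT).
    by apply: markov_ext => y; rewrite mulN1r.
  by have := f0 x; lra.
have [|u [v uv]] := @markov_decomposition T gamma r mT.
  by move=> f /inj.
have u0 s : u s = 0 by apply: inj => x; case: (uv x).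
by exists v => s; have [_ ->] := uv s; rewrite u0; ring.
Qed.

Lemma markov_fix_iter T f : markov_op T -> (forall s, T f s = f s) ->
  forall t s, iter t T f s = f s.
Proof.
move=> mT fT; elim=> [|t IH] s //=; rewrite -[RHS]fT.
by apply: markov_ext.
Qed.

Lemma bounded_vanish (k : R) : (forall t : nat, t%:R * `|k| <= 1) -> k = 0.
Proof.
move=> H; apply/eqP/negPn/negP => k0.
have kp : 0 < `|k| by rewrite normr_gt0.
have := H (Num.truncn (`|k|^-1)).+1; apply/negP; rewrite -ltNge.
have := truncnS_gt (`|k|^-1); rewrite -(ltr_pM2r kp) mulVf //; exact: lt0r_neq0.
Qed.

(* Iterating [f - T f = y] with [T y = y] gives [T^t f = f - t y], so
   boundedness of [T^t f] forces [y = 0]: 1 is a semisimple eigenvalue. *)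
Lemma markov_ergodic_decomposition T (r : S -> R) : markov_op T ->
  exists rho g : S -> R, let h := fun s => g s - T g s in
    (forall s, T rho s = rho s) /\ (forall s, r s = rho s + (h s - T h s)).
Proof.
move=> mT.
have ss f : (forall s, (f s - 1 * T f s) - 1 * T (fun x => f x - 1 * T f x) s = 0) ->
    forall s, f s - 1 * T f s = 0.
  move=> E; pose y s := f s - 1 * T f s.
  have Ty s : T y s = y s by have := E s; rewrite -/(y) /y; lra.
  have it t s : iter t T f s = f s - t%:R * y s.
    elim: t s => [|t IH] s; first by rewrite mul0r subr0.
    rewrite iterS (@markov_ext T _ (fun x => f x - t%:R * y x)) //.
    rewrite markovB // markovZ // Ty -natr1 /y; ring.
  have [M M0 fM] := fun_bounded f.
  move=> s; rewrite -/(y s).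
  suff : y s / (2 * M + 1) = 0.
    by move=> /eqP; rewrite mulf_eq0 invr_eq0 => /orP[/eqP //|/eqP]; lra.
  apply: bounded_vanish => t.
  have M1 : 0 < 2 * M + 1 by lra.
  rewrite normrM normfV (gtr0_norm M1) mulrA ler_pdivrMr // mul1r.
  have -> : t%:R * `|y s| = `|f s - iter t T f s|.
    by rewrite it opprB addrC subrK normrM ger0_norm.
  apply: (le_trans (ler_normB _ _)).
  have := fM s; have := @markov_norm _ _ _ (markov_iter t mT) fM s; lra.
have [u [v uv]] := @markov_decomposition T 1 r mT ss.
(* Splitting [v] once more puts [h] itself in the image of [I - T]. This normalization makes the
   Cesaro means of [T^t h] vanish and so singles out the bias among the solutions of the Poisson
   equation. *)
have [u2 [v2 uv2]] := @markov_decomposition T 1 v mT ss.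
exists u, v2 => h; split=> s; first by have [] := uv s; rewrite mul1r; lra.
have [_ ->] := uv s; congr (_ + _); rewrite mul1r.
have Th : T h s = T v s - T u2 s.
  rewrite -markovB //; apply: markov_ext => x; rewrite /h.
  by have [_] := uv2 x; rewrite mul1r; lra.
have [] := uv2 s; rewrite !mul1r Th /h; lra.
Qed.

End MarkovOperators.

Section Limits.
Variable R : realType.

Lemma limn_vanishing (u e : nat -> R) (l : R) :
  e @ \oo --> (0 : R) -> (forall T, (0 < T)%N -> `|u T - l| <= e T) ->
  limn u = l.
Proof.
move=> e0 H; apply/cvg_lim => //; apply/cvgrPdistC_le => eps eps0.
move/cvgrPdistC_lt : e0 => /(_ eps eps0) e0.
near=> T; have T0 : (0 < T)%N by near: T; exact: nbhs_infty_gt.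
apply: (le_trans (H T T0)); apply/ltW/(le_lt_trans (ler_norm _)).
rewrite -[X in `|X|]subr0; near: T; exact: e0.
Unshelve. all: by end_near. Qed.

Lemma limn_harmonic_rate (u : nat -> R) (l M : R) :
  (forall T, (0 < T)%N -> `|u T - l| <= M * T%:R^-1) -> limn u = l.
Proof.
move=> H; apply: (@limn_vanishing u (fun T => M * T%:R^-1)) => //.
rewrite -(mulr0 M); apply: cvgM; first exact: cvg_cst.
rewrite -(cvg_shiftn 1); have := @cvg_harmonic R; apply: cvg_trans.
by apply: near_eq_cvg; near=> T; rewrite /= addn1.
Unshelve. all: by end_near. Qed.

Lemma limn_geometric_rate (u : nat -> R) (l M gamma : R) : 0 <= gamma < 1 ->
  (forall T, `|u T - l| <= M * gamma ^+ T) -> limn u = l.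
Proof.
move=> /andP[g0 g1] H; apply: (@limn_vanishing u (fun T => M * gamma ^+ T)) => //.
by apply: cvg_geometric; rewrite ger0_norm.
Qed.

(** Used with [e = 1 - gamma] to pass from discounted comparisons to average-reward ones. *)
Lemma le_of_vanishing_error (a b K e0 : R) : 0 < e0 ->
  (forall e, 0 < e < e0 -> a <= b + e * K) -> a <= b.
Proof.
move=> e00 H; rewrite leNgt; apply/negP => ba.
have Kp : 0 < `|K| + 1 by have := normr_ge0 K; lra.
pose e := Num.min (e0 / 2) ((a - b) / (2 * (`|K| + 1))).
have e1 : e <= e0 / 2 by rewrite ge_min lexx.
have e2 : e <= (a - b) / (2 * (`|K| + 1)) by rewrite ge_min lexx orbT.
have ep : 0 < e by rewrite lt_min divr_gt0 ?divr_gt0 //; lra.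
have : a <= b + e * K by apply: H; lra.
have : e * (2 * (`|K| + 1)) <= a - b by rewrite -ler_pdivlMr //; lra.
have : e * K <= e * `|K| by rewrite ler_pM2l // ler_norm.
by lra.
Qed.

Lemma le_of_linear_growth (a b K : R) :
  (forall n : nat, n%:R * a <= n%:R * b + K) -> a <= b.
Proof.
move=> H; apply: (@le_of_vanishing_error a b `|K| 1) => // e /andP[e0 _].
have [n nE] : exists n : nat, e^-1 <= n.+1%:R.
  by exists (Num.truncn e^-1); rewrite ltW // truncnS_gt.
have := H n.+1; have np : (0 : R) < n.+1%:R by rewrite ltr0n.
have : 1 <= n.+1%:R * e by rewrite -ler_pdivrMr // div1r.
have := ler_norm K; have := normr_ge0 K.
move=> K0 K1 ne Hn; rewrite -(ler_pM2l np) mulrDr; nra.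
Qed.

End Limits.

(** * Gain, bias and discounted value of a Markov chain with rewards *)

Section MarkovRewards.
Variables (R : realType) (S : finType).
Variable (T : (S -> R) -> S -> R).
Hypothesis mT : markov_op T.
Implicit Types (r f g rho h W : S -> R).

Lemma sum_markov_iter r rho h : (forall s, T rho s = rho s) ->
  (forall s, r s = rho s + (h s - T h s)) ->
  forall n s, \sum_(t < n) iter t T r s = n%:R * rho s + (h s - iter n T h s).
Proof.
move=> Trho rE; elim=> [|n IH] s; first by rewrite big_ord0 /=; ring.
rewrite big_ord_recr /= IH.
have -> : iter n T r s = rho s + (iter n T h s - iter n T (T h) s).
  have mn := markov_iter n mT; rewrite -(markovB _ _ mn).
  rewrite -{1}(markov_fix_iter mT Trho n s) -(markovD _ _ mn).
  by apply: markov_ext => x; rewrite rE.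
by rewrite -iterSr iterS -natr1; ring.
Qed.

Lemma markov_gain_lim r rho h : (forall s, T rho s = rho s) ->
  (forall s, r s = rho s + (h s - T h s)) ->
  forall s, limn (fun n : nat => n%:R^-1 * \sum_(t < n) iter t T r s) = rho s.
Proof.
move=> Trho rE s; have [M M0 hM] := fun_bounded h.
apply: (@limn_harmonic_rate _ _ _ (2 * M)) => n n0.
have nz : (n%:R : R) != 0 by rewrite pnatr_eq0 -lt0n.
rewrite (sum_markov_iter Trho rE) mulrDr mulKf // addrAC subrr add0r.
rewrite normrM mulrC normfV normr_nat ler_wpM2r //.
apply: (le_trans (ler_normB _ _)).
have := hM s; have := markov_norm (markov_iter n mT) hM s; lra.
Qed.

(** By the Poisson equation, [D = h - W] satisfies [k + T D <= rho + D]. Iterating gives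
    [n k + T^n D <= n rho + D], where [D] is bounded; divide by [n]. *)
Lemma markov_gain_ge r rho h W (k : R) : (forall s, T rho s = rho s) ->
  (forall s, r s = rho s + (h s - T h s)) ->
  (forall s, k <= r s + T W s - W s) -> forall s, k <= rho s.
Proof.
move=> Trho rE kW s; pose D x := h x - W x.
have [M M0 DM] := fun_bounded D.
apply: (@le_of_linear_growth _ _ _ (2 * M)) => n.
have H x : k + T D x <= rho x + D x.
  by have := kW x; rewrite rE /D (markovB _ _ mT); lra.
have : n%:R * k + iter n T D s <= n%:R * rho s + D s.
  elim: n => [|n IH]; first by rewrite /=; lra.
  have mn := markov_iter n mT; case: (mn) => _ mon cst.
  have := mon _ _ H s; rewrite (markovD _ _ mn) cst (markovD _ _ mn).
  rewrite (markov_fix_iter mT Trho) -iterSr -natr1; lra.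
have := markov_norm (markov_iter n mT) DM s; rewrite ler_norml => /andP[].
have := DM s; rewrite ler_norml => /andP[]; lra.
Qed.

(** The partial sums are [h - T^k h], and [T^k h = T^k g - T^(k+1) g] telescopes, so its Cesaro mean
    is O(1/n). *)
Lemma markov_bias_lim r rho g : let h := fun s => g s - T g s in
  (forall s, T rho s = rho s) -> (forall s, r s = rho s + (h s - T h s)) ->
  forall s, limn (fun n : nat => n%:R^-1 *
    \sum_(k < n) \sum_(t < k.+1) (iter t T r s - iter t T rho s)) = h s.
Proof.
move=> h Trho rE s; have [M M0 gM] := fun_bounded g.
apply: (@limn_harmonic_rate _ _ _ (2 * M)) => n n0.
have nz : (n%:R : R) != 0 by rewrite pnatr_eq0 -lt0n.
have E k : \sum_(t < k) (iter t T r s - iter t T rho s) = h s - iter k T h s.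
  rewrite sumrB (sum_markov_iter Trho rE).
  rewrite (eq_bigr (fun=> rho s)); last by move=> i _; rewrite (markov_fix_iter mT).
  by rewrite sumr_const card_ord mulr_natl; ring.
have -> : \sum_(k < n) \sum_(t < k.+1) (iter t T r s - iter t T rho s) =
    n%:R * h s - (T g s - iter n.+1 T g s).
  under eq_bigr do rewrite E.
  rewrite sumrB sumr_const card_ord mulr_natl; congr (_ - _).
  elim: n {n0 nz} => [|n IH]; first by rewrite big_ord0 subrr.
  rewrite big_ord_recr IH /=.
  have -> : T (iter n T h) s = T (iter n T g) s - T (T (iter n T g)) s.
    have := markovB g (T g) (markov_iter n.+1 mT) s.
    by rewrite -iterSr !iterS /h => <-.
  by ring.
rewrite mulrBr mulKf // addrAC subrr add0r normrN.
rewrite normrM mulrC normfV normr_nat ler_wpM2r //.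
apply: (le_trans (ler_normB _ _)).
have := markov_norm mT gM s; have := markov_norm (markov_iter n.+1 mT) gM s; lra.
Qed.

Lemma markov_disc_lim r gamma V : 0 <= gamma < 1 ->
  (forall s, V s = r s + gamma * T V s) ->
  forall s, limn (fun n : nat => \sum_(t < n) gamma ^+ t * iter t T r s) = V s.
Proof.
move=> hg VE s; have [M M0 VM] := fun_bounded V; have /andP[g0 _] := hg.
apply: (@limn_geometric_rate _ _ _ M _ hg) => n.
have -> : \sum_(t < n) gamma ^+ t * iter t T r s = V s - gamma ^+ n * iter n T V s.
  elim: n => [|n IH]; first by rewrite big_ord0 expr0 /=; ring.
  rewrite big_ord_recr /= IH exprS.
  have -> : iter n T r s = iter n T V s - gamma * T (iter n T V) s.
    have mn := markov_iter n mT.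
    rewrite -iterS iterSr -(markovZ _ _ mn) -(markovB _ _ mn).
    by apply: markov_ext => x; rewrite VE; ring.
  by ring.
rewrite addrAC subrr add0r normrN normrM mulrC (ger0_norm (exprn_ge0 n g0)).
by rewrite ler_wpM2r ?exprn_ge0 //; exact: markov_norm (markov_iter n mT) VM s.
Qed.

Lemma markov_contraction_le gamma f k : 0 <= gamma < 1 ->
  (forall s, f s <= gamma * T f s + (1 - gamma) * k) -> forall s, f s <= k.
Proof.
move=> hg H s; rewrite -subr_le0.
apply: (@markov_contraction _ _ _ _ (fun x => f x - k) mT hg) => x.
have := H x; rewrite (markovB f (fun=> k) mT); case: mT => _ _ ->; lra.
Qed.

(* Laurent expansion of the discounted value at [gamma = 1]. *)
Lemma markov_disc_expansion r rho g : let h := fun s => g s - T g s in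
  (forall s, T rho s = rho s) -> (forall s, r s = rho s + (h s - T h s)) ->
  exists M, forall gamma V, 0 <= gamma < 1 ->
    (forall s, V s = r s + gamma * T V s) ->
    forall s, `|(1 - gamma) * V s - rho s - (1 - gamma) * h s| <= (1 - gamma) ^+ 2 * M.
Proof.
move=> h Trho rE; have [M M0 gM] := fun_bounded g.
exists (2 * M) => gamma V hg VE s; have /andP[g0 g1] := hg.
(* Without its last term [D] would solve the discounted equation with reward [-(1 - gamma)^2 T h].
   As [T h = T g - T (T g)], the corrector [(1 - gamma)^2 T g] leaves only a reward of third order,
   of which the contraction loses one. *)
pose D x := (1 - gamma) * V x - rho x - (1 - gamma) * h x + (1 - gamma) ^+ 2 * T g x.
have DE x : D x = gamma * T D x + (1 - gamma) ^+ 3 * T (T g) x.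
  rewrite /D (markovD _ _ mT) (markovZ _ _ mT).
  rewrite (markovB _ (fun y => (1 - gamma) * h y) mT) (markovZ _ _ mT).
  rewrite (markovB (fun y => (1 - gamma) * V y) rho mT) (markovZ _ _ mT) Trho.
  have -> : T h x = T g x - T (T g) x by exact: markovB.
  rewrite VE rE /h (markovB _ _ mT); ring.
have TM x : `|T (T g) x| <= M by apply: markov_norm => //; exact: markov_norm.
have D1 x : D x <= (1 - gamma) ^+ 2 * M.
  apply: (@markov_contraction_le gamma D _ hg) => y; rewrite {1}DE lerD2l exprS -mulrA.
  rewrite ler_wpM2l ?subr_ge0 ?(ltW g1) // ler_wpM2l ?sqr_ge0 //.
  exact: le_trans (ler_norm _) (TM y).
have D2 x : - D x <= (1 - gamma) ^+ 2 * M.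
  apply: (@markov_contraction_le gamma (fun x => - D x) _ hg) => y.
  rewrite (@markov_ext _ _ T (fun x => - D x) (fun x => -1 * D x)); last first.
    by move=> z; rewrite mulN1r.
  rewrite (markovZ _ _ mT) {1}DE opprD mulN1r mulrN lerD // exprS -mulrN -mulrA.
  rewrite ler_wpM2l ?subr_ge0 ?(ltW g1) // ler_wpM2l ?sqr_ge0 //.
  by apply: le_trans (TM y); rewrite -normrN ler_norm.
have Tg : `|T g s| <= M by exact: markov_norm.
have e2 : 0 <= (1 - gamma) ^+ 2 by exact: sqr_ge0.
have B : `|(1 - gamma) ^+ 2 * T g s| <= (1 - gamma) ^+ 2 * M.
  by rewrite normrM ger0_norm // ler_wpM2l.
have := D1 s; have := D2 s; move: B; rewrite /D !ler_norml => /andP[B1 B2] E1 E2.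
by apply/andP; split; lra.
Qed.

End MarkovRewards.

(** * Discounted and average-reward MDPs *)

Section Policies.
Variables (R : realType) (S A : finType).
Implicit Types (P : S -> A -> S -> R) (pi : S -> A -> R) (r : S -> A -> R).
Implicit Types (d : S -> A) (f g V W : S -> R).

Definition avg P s a f : R := \sum_(s' : S) P s a s' * f s'.

Lemma avg_markov P a : is_kernel P -> markov_op (fun f s => avg P s a f).
Proof.
case=> P0 P1; split=> [k f g s|f g fg s|k s]; rewrite /avg.
- rewrite mulr_sumr -big_split /=; apply: eq_bigr => x _; ring.
- by apply: ler_sum => x _; exact: ler_wpM2l.
- by rewrite -mulr_suml P1 mul1r.
Qed.

Lemma policy_avg_le pi s (F : A -> R) k : is_policy pi ->
  (forall a, F a <= k) -> \sum_a pi s a * F a <= k.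
Proof.
case=> p0 p1 Fk; rewrite -[leRHS]mul1r -(p1 s) mulr_suml.
by apply: ler_sum => a _; exact: ler_wpM2l.
Qed.

Lemma policy_avg_ge pi s (F : A -> R) k : is_policy pi ->
  (forall a, k <= F a) -> k <= \sum_a pi s a * F a.
Proof.
case=> p0 p1 Fk; rewrite -[leLHS]mul1r -(p1 s) mulr_suml.
by apply: ler_sum => a _; exact: ler_wpM2l.
Qed.

Lemma stepE P pi f s : step P pi f s = \sum_a pi s a * avg P s a f.
Proof. by []. Qed.

Lemma step_markov P pi : is_kernel P -> is_policy pi -> markov_op (step P pi).
Proof.
move=> kP [p0 p1]; split=> [k f g s|f g fg s|k s]; rewrite !stepE.
- rewrite mulr_sumr -big_split /=; apply: eq_bigr => a _.
  by case: (avg_markov a kP) => -> _ _; ring.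
- apply: ler_sum => a _; apply: ler_wpM2l => //.
  by case: (avg_markov a kP) => _ mon _; exact: mon.
- under eq_bigr => a _.
    by case: (avg_markov a kP) => _ _ ->; over.
  by rewrite -mulr_suml p1 mul1r.
Qed.

Lemma det_policyP d : is_policy (det_policy d : S -> A -> R).
Proof.
split=> [s a|s]; rewrite /det_policy; first by case: eqP.
by rewrite -big_mkcond big_pred1_eq.
Qed.

Lemma sum_det_policy d s (F : A -> R) :
  \sum_a det_policy d s a * F a = F (d s).
Proof.
rewrite (bigD1 (d s)) //= /det_policy eqxx mul1r big1 ?addr0 // => a /negbTE ->.
by rewrite mul0r.
Qed.

Lemma step_det P d f s : step P (det_policy d) f s = avg P s (d s) f.
Proof. exact: sum_det_policy. Qed.

Lemma rew_det r d s : rew_pi r (det_policy d) s = r s (d s).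
Proof. exact: sum_det_policy. Qed.

Lemma backup_policy P pi r gamma f s :
  rew_pi r pi s + gamma * step P pi f s =
  \sum_a pi s a * (r s a + gamma * avg P s a f).
Proof.
rewrite stepE /rew_pi mulr_sumr -big_split /=.
by apply: eq_bigr => a _; ring.
Qed.

Section Discounted.
Variables (P : S -> A -> S -> R) (r : S -> A -> R) (gamma : R).
Hypotheses (kP : is_kernel P) (hg : 0 <= gamma < 1).

Lemma disc_value_bellman pi : is_policy pi -> forall s,
  disc_value P r pi gamma s = rew_pi r pi s + gamma * step P pi (disc_value P r pi gamma) s.
Proof.
move=> hp; have mT := step_markov kP hp.
have [V VE] := @markov_fixpoint _ _ _ gamma (rew_pi r pi) mT hg.
have E : disc_value P r pi gamma = V.
  by apply/funext => s; exact: (markov_disc_lim mT hg VE).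
by move=> s; rewrite E.
Qed.

Lemma le_disc_value pi W : is_policy pi ->
  (forall s, W s <= rew_pi r pi s + gamma * step P pi W s) ->
  forall s, W s <= disc_value P r pi gamma s.
Proof.
move=> hp H s; have mT := step_markov kP hp; rewrite -subr_le0.
apply: (@markov_contraction _ _ _ _ (fun x => W x - disc_value P r pi gamma x) mT hg) => x.
rewrite (markovB _ _ mT) mulrBr {1}(disc_value_bellman hp); have := H x; lra.
Qed.

Lemma disc_value_le pi W : is_policy pi ->
  (forall s, rew_pi r pi s + gamma * step P pi W s <= W s) ->
  forall s, disc_value P r pi gamma s <= W s.
Proof.
move=> hp H s; have mT := step_markov kP hp; rewrite -subr_le0.
apply: (@markov_contraction _ _ _ _ (fun x => disc_value P r pi gamma x - W x) mT hg) => x.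
rewrite (markovB _ _ mT) mulrBr {1}(disc_value_bellman hp); have := H x; lra.
Qed.

Lemma backup_le_disc_value pi V : is_policy pi ->
  (forall s, V s <= rew_pi r pi s + gamma * step P pi V s) ->
  forall s, rew_pi r pi s + gamma * step P pi V s <= disc_value P r pi gamma s.
Proof.
move=> hp H s; rewrite (disc_value_bellman hp) lerD2l.
have /andP[g0 _] := hg; apply: ler_wpM2l => //.
by have [_ mon _] := step_markov kP hp; apply: mon; exact: le_disc_value.
Qed.

(** Among the finitely many deterministic policies, take one maximizing the sum of its values over
    all states. Were [a] strictly better at [s], switching to it there would lower no value and
    raise the one at [s]. *)
Lemma exists_greedy_policy (a0 : A) : exists d,
  let V := disc_value P r (det_policy d) gamma in
  forall s a, r s a + gamma * avg P s a V <= V s.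
Proof.
pose val (d : {ffun S -> A}) : R := \sum_s disc_value P r (det_policy d) gamma s.
have [d dmax] := @exists_argmax R {ffun S -> A} val [ffun=> a0].
exists d => V s a; rewrite leNgt; apply/negP => lt_Va.
pose d' : {ffun S -> A} := [ffun x => if x == s then a else d x].
have imp x : V x <= rew_pi r (det_policy d') x + gamma * step P (det_policy d') V x.
  rewrite rew_det step_det ffunE; case: eqP => [->|_]; first exact: ltW.
  rewrite [leLHS](disc_value_bellman (det_policyP d)).
  by rewrite rew_det step_det.
have V'1 x : V x <= disc_value P r (det_policy d') gamma x.
  exact: (le_disc_value (det_policyP d')).
have V'2 : V s < disc_value P r (det_policy d') gamma s.
  apply: lt_le_trans (backup_le_disc_value (det_policyP d') imp s).
  by rewrite rew_det step_det ffunE eqxx.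
have := dmax d'; apply/negP; rewrite -ltNge /val.
rewrite (bigD1 s) //= [ltRHS](bigD1 s) //=.
by apply: ltr_leD => //; exact: ler_sum.
Qed.

Lemma sup_attained (E : set R) (x : R) : E x -> ubound E x -> sup E = x.
Proof.
move=> Ex ub; apply/eqP; rewrite eq_le; apply/andP; split.
  by apply: ge_sup => //; exists x.
by apply: ub_le_sup => //; exists x.
Qed.

Lemma opt_disc_value_bellman (a0 : A) : exists d,
  let U := opt_disc_value P r gamma in
  [/\ U = disc_value P r (det_policy d) gamma,
      forall s, U s = r s (d s) + gamma * avg P s (d s) U
    & forall s a, r s a + gamma * avg P s a U <= U s].
Proof.
have [d /= dP] := exists_greedy_policy a0; exists d; set U := opt_disc_value P r gamma.
have UE : U = disc_value P r (det_policy d) gamma.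
  apply/funext => s; apply: sup_attained.
    by exists (det_policy d) => //; exact: det_policyP.
  move=> _ [pi hp <-]; apply: (disc_value_le hp) => x.
  by rewrite backup_policy; apply: policy_avg_le.
split=> // s; last by rewrite UE; exact: dP.
by rewrite UE {1}(disc_value_bellman (det_policyP d)) rew_det step_det.
Qed.

Lemma disc_value_le_opt pi : (0 < #|A|)%N -> is_policy pi ->
  forall s, disc_value P r pi gamma s <= opt_disc_value P r gamma s.
Proof.
move=> /card_gt0P[a0 _] hp; have [d /= [_ _ opt]] := opt_disc_value_bellman a0.
by apply: (disc_value_le hp) => x; rewrite backup_policy; apply: policy_avg_le.
Qed.

Lemma opt_disc_value_le W : (0 < #|A|)%N ->
  (forall s a, r s a + gamma * avg P s a W <= W s) ->
  forall s, opt_disc_value P r gamma s <= W s.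
Proof.
move=> /card_gt0P[a0 _] H s; have [d /= [-> _ _]] := opt_disc_value_bellman a0.
by apply: (disc_value_le (det_policyP d)) => x; rewrite rew_det step_det.
Qed.

End Discounted.

Section AverageReward.
Variables (P : S -> A -> S -> R) (r : S -> A -> R).
Hypothesis kP : is_kernel P.

(** Identifies the limits defining [gain] and [bias] with the algebraic decomposition of the reward;
    the limits are not manipulated directly afterwards. *)
Lemma gain_bias_expansion pi : is_policy pi ->
  [/\ forall s, step P pi (gain P r pi) s = gain P r pi s,
      forall s, rew_pi r pi s =
        gain P r pi s + (bias P r pi s - step P pi (bias P r pi) s)
    & exists M, forall gamma, 0 <= gamma < 1 -> forall s,
        `|(1 - gamma) * disc_value P r pi gamma s - gain P r pi s
          - (1 - gamma) * bias P r pi s| <= (1 - gamma) ^+ 2 * M].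
Proof.
move=> hp; have mT := step_markov kP hp.
have [rho [g [Trho rE]]] := markov_ergodic_decomposition (rew_pi r pi) mT.
set h := fun s => g s - step P pi g s in rE.
have gE : gain P r pi = rho by apply/funext => s; exact: (markov_gain_lim mT Trho rE).
have bE : bias P r pi = h.
  by apply/funext => s; rewrite /bias gE; exact: (markov_bias_lim mT Trho rE).
rewrite gE bE; split=> //.
have [M HM] := markov_disc_expansion mT Trho rE.
by exists M => gamma hg s; apply: HM => // x; exact: disc_value_bellman.
Qed.

Lemma le_gain pi W k : is_policy pi ->
  (forall s, k <= rew_pi r pi s + step P pi W s - W s) ->
  forall s, k <= gain P r pi s.
Proof.
move=> hp H; have [g1 g2 _] := gain_bias_expansion hp.
exact: (markov_gain_ge (step_markov kP hp) g1 g2 H).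
Qed.

Lemma gain_le pi k : is_policy pi -> (forall s a, r s a <= k) ->
  forall s, gain P r pi s <= k.
Proof.
move=> hp rk s; have mT := step_markov kP hp.
have [g1 g2 _] := gain_bias_expansion hp; rewrite -lerN2.
apply: (@markov_gain_ge _ _ _ mT (fun x => - rew_pi r pi x) (fun x => - gain P r pi x)
  (fun x => - bias P r pi x) (fun=> 0)) => {s} s.
- have := markovZ (-1) (gain P r pi) mT s; rewrite mulN1r g1 => <-.
  by apply: markov_ext => x; rewrite mulN1r.
- have := markovZ (-1) (bias P r pi) mT s; rewrite mulN1r g2 => E.
  rewrite (@markov_ext _ _ _ (fun x => - bias P r pi x) (fun x => -1 * bias P r pi x)).
    by rewrite E; ring.
  by move=> x; rewrite mulN1r.
- case: (mT) => _ _ ->; have : rew_pi r pi s <= k by exact: policy_avg_le.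
  lra.
Qed.

Section Blackwell.
Variable pi : S -> A -> R.
Hypothesis bw : blackwell_optimal P r pi.

(** If the inequality failed at [(s, a)], playing [a] at [s] and [pi] elsewhere would beat [pi] at
    [s]. The bound [e0 <= 1] keeps [gamma] nonnegative. *)
Lemma blackwell_bellman : exists2 e0 : R, 0 < e0 <= 1 & forall gamma, 1 - e0 < gamma < 1 ->
  let V := disc_value P r pi gamma in
  (forall s a, r s a + gamma * avg P s a V <= V s) /\
  (forall pi', is_policy pi' -> forall s, disc_value P r pi' gamma s <= V s).
Proof.
case: bw => hp [g0 [g01 opt]].
exists (Num.min (1 - g0) 1).
  by rewrite lt_min ge_min lexx orbT ltr01 subr_gt0 g01.
move=> gamma /andP[]; rewrite ltrBlDl -ltrBlDr lt_min => /andP[h1 h2] g1 V.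
have h0 : g0 < gamma by lra.
have hg : 0 <= gamma < 1 by apply/andP; split; lra.
split=> [s a|pi' hp']; last by exact: opt.
rewrite leNgt; apply/negP => lt_Va.
pose pi' x b : R := if x == s then (b == a)%:R else pi x b.
have hp' : is_policy pi'.
  case: hp => p0 p1; split=> [x b|x]; rewrite /pi'; first by case: eqP.
  case: eqP => // _; rewrite (bigD1 a) //= eqxx big1 ?addr0 // => b /negbTE ->.
  by [].
have bE : rew_pi r pi' s + gamma * step P pi' V s = r s a + gamma * avg P s a V.
  rewrite backup_policy /pi' eqxx (bigD1 a) //= eqxx mul1r big1 ?addr0 //.
  by move=> b /negbTE ->; rewrite mul0r.
have imp x : V x <= rew_pi r pi' x + gamma * step P pi' V x.
  case: (eqVneq x s) => [->|xs]; first by rewrite bE ltW.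
  rewrite [leLHS](disc_value_bellman r kP hg hp) !backup_policy.
  by rewrite /pi' (negbTE xs).
have := opt gamma h0 g1 pi' hp' s; apply/negP; rewrite -ltNge.
apply: lt_le_trans (backup_le_disc_value kP hg hp' imp s).
by rewrite bE.
Qed.

(** Multiply the discounted comparison by [e = 1 - gamma], insert both Laurent expansions and let
    [e] tend to 0. *)
Lemma blackwell_gain_max pi' : is_policy pi' ->
  forall s, gain P r pi' s <= gain P r pi s.
Proof.
move=> hp' s; have [e0 /andP[e00 e01] H] := blackwell_bellman; case: (bw) => hp _.
have [_ _ [M HM]] := gain_bias_expansion hp.
have [_ _ [M' HM']] := gain_bias_expansion hp'.
apply: (@le_of_vanishing_error _ _ _ (`|bias P r pi s| + `|bias P r pi' s| + `|M| + `|M'|) e0) => //.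
move=> e /andP[e1 e2].
have hg : 0 <= 1 - e < 1 by apply/andP; split; lra.
have [|_ /(_ _ hp' s)] := H (1 - e); first by apply/andP; split; lra.
have := HM _ hg s; have := HM' _ hg s; rewrite subKr !ler_norml => /andP[a1 a2] /andP[b1 b2] V.
have V' : e * disc_value P r pi' (1 - e) s <= e * disc_value P r pi (1 - e) s.
  by rewrite ler_pM2l.
have e4 : 0 <= e ^+ 2 by exact: sqr_ge0.
have e3 : e ^+ 2 <= e by rewrite expr2; nra.
have qM (m : R) : e ^+ 2 * m <= e * `|m|.
  by apply: (le_trans (ler_wpM2l e4 (ler_norm m))); exact: ler_wpM2r.
have q1 := qM M; have q2 := qM M'.
have q3 : e * bias P r pi s <= e * `|bias P r pi s| by rewrite ler_pM2l // ler_norm.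
have q4 : e * - bias P r pi' s <= e * `|bias P r pi' s|.
  by rewrite ler_pM2l // -normrN ler_norm.
by rewrite !mulrDr; lra.
Qed.

Lemma blackwell_opt_gain s : opt_gain P r s = gain P r pi s.
Proof.
case: (bw) => hp _; apply: sup_attained; first by exists pi.
by move=> _ [pi' hp' <-]; exact: blackwell_gain_max.
Qed.

End Blackwell.
End AverageReward.
End Policies.

Arguments det_policyP {R S A} d.

(** * Hitting probabilities and recurrent states *)

Section Recurrence.
Variables (R : realType) (S A : finType).
Variables (P : S -> A -> S -> R) (pi : S -> A -> R).
Hypotheses (kP : is_kernel P) (hp : is_policy pi).

Let p x x' := \sum_a pi x a * P x a x'.

Let stepp f x : step P pi f x = \sum_x' p x x' * f x'.
Proof.
rewrite /step /p; under eq_bigr do rewrite mulr_sumr.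
rewrite exchange_big /=; apply: eq_bigr => x' _; rewrite mulr_suml.
by apply: eq_bigr => a _; rewrite mulrA.
Qed.

Let p_ge0 x x' : 0 <= p x x'.
Proof. by case: kP hp => P0 _ [p0 _]; apply: sumr_ge0 => a _; exact: mulr_ge0. Qed.

Let p_sum1 x : \sum_x' p x x' = 1.
Proof.
case: (step_markov kP hp) => _ _ /(_ 1 x); rewrite stepp => <-.
by apply: eq_bigr => x' _; rewrite mulr1.
Qed.

Let closed (M : {set S}) := [forall x in M, forall x', (0 < p x x') ==> (x' \in M)].

Let closedP (M : {set S}) : reflect (forall x x', x \in M -> 0 < p x x' -> x' \in M) (closed M).
Proof.
apply: (iffP forall_inP) => [H x x' xM px|H x xM].
  by have /forallP/(_ x')/implyP := H x xM; exact.
by apply/forallP => x'; apply/implyP; exact: H.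
Qed.

Let max_principle f m x : (forall x', 0 < p x x' -> f x' <= m) ->
  m <= step P pi f x -> forall x', 0 < p x x' -> f x' = m.
Proof.
move=> fm; rewrite stepp => mf x' px'.
have t0 z : 0 <= p x z * (m - f z).
  case: (ltgtP 0 (p x z)) (p_ge0 x z) => // [pz|<-] _; last by rewrite mul0r.
  by rewrite mulr_ge0 // subr_ge0 fm.
have : \sum_z p x z * (m - f z) <= 0.
  under eq_bigr do rewrite mulrBr.
  by rewrite sumrB -mulr_suml p_sum1 mul1r subr_le0.
rewrite (bigD1 x') //= => H.
have : 0 <= \sum_(z | z != x') p x z * (m - f z) by exact: sumr_ge0.
have := t0 x'; have := fm _ px'; nra.
Qed.

Section Hitting.
Variable y : S.

Let hit_ge0_le1 T x : 0 <= hit P pi y T x <= 1.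
Proof.
have mT := step_markov kP hp; elim: T x => [|T IH] x /=; first by rewrite lexx ler01.
apply/andP; split.
  apply: (@markov_ge _ _ _ (fun x' => if x' == y then 1 else hit P pi y T x') _ mT).
  by move=> z; case: eqP => // _; case/andP: (IH z).
apply: (@markov_le _ _ _ (fun x' => if x' == y then 1 else hit P pi y T x') _ mT).
by move=> z; case: eqP => // _; case/andP: (IH z).
Qed.

Let hit_nd x : nondecreasing_seq (fun T => hit P pi y T x).
Proof.
apply/nondecreasing_seqP => T; have [_ mon _] := step_markov kP hp.
elim: T x => [|T IH] x; first by case/andP: (hit_ge0_le1 1 x).
apply: (mon (fun x' => if x' == y then 1 else hit P pi y T x')
            (fun x' => if x' == y then 1 else hit P pi y T.+1 x')).
by move=> z; case: eqP.
Qed.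

Lemma is_cvg_hit x : cvgn (fun T => hit P pi y T x).
Proof.
apply: nondecreasing_is_cvgn; first exact: hit_nd.
by exists 1 => _ [T _ <-]; case/andP: (hit_ge0_le1 T x).
Qed.

Lemma hit_prob_le1 x : hit_prob P pi y x <= 1.
Proof.
apply: limr_le; first exact: is_cvg_hit.
by apply: nearW => T; case/andP: (hit_ge0_le1 T x).
Qed.

Lemma hit_prob_fix x : hit_prob P pi y x =
  step P pi (fun x' => if x' == y then 1 else hit_prob P pi y x') x.
Proof.
rewrite [LHS]/hit_prob; apply/cvg_lim => //; rewrite -(cvg_shiftn 1) stepp.
under eq_fun do rewrite addn1 [hit _ _ _ _ _](stepp (fun x' => if x' == y then 1 else hit P pi y _ x')).
apply: cvg_big => [|x' _]; first exact: add_continuous.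
apply: cvgM; first exact: cvg_cst.
by case: eqP => _; [exact: cvg_cst|exact: is_cvg_hit].
Qed.

(** Optional stopping at the hitting time of [y], proved by induction on the horizon of [hit]. *)
Lemma superharmonic_hit f x : (forall z, 0 <= f z) ->
  (forall z, step P pi f z <= f z) -> f y * hit_prob P pi y x <= f x.
Proof.
move=> f0 Pf; have mT := step_markov kP hp.
have H T z : f y * hit P pi y T z <= f z.
  elim: T z => [|T IH] z; first by rewrite /= mulr0.
  apply: le_trans (Pf z); rewrite /= -[leLHS](markovZ (f y) _ mT).
  case: mT => _ mon _; apply: mon => w.
  by case: eqP => [->|_] //; rewrite mulr1.
have := f0 y; rewrite le_eqVlt => /predU1P[<-|fy0]; first by rewrite mul0r.
rewrite mulrC -ler_pdivlMr //; apply: limr_le; first exact: is_cvg_hit.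
by apply: nearW => T; rewrite ler_pdivlMr // mulrC.
Qed.

End Hitting.

(* In a minimal closed class, the probability of never reaching [y] is
   subharmonic, so it is maximal on a closed subset avoiding [y]: it vanishes. *)
Lemma closed_class_recurrent (M0 : {set S}) (x0 : S) : x0 \in M0 ->
  (forall x x', x \in M0 -> 0 < p x x' -> x' \in M0) ->
  exists2 y, y \in M0 & ~ transient P pi y.
Proof.
move=> x0M0 /closedP cM0.
have [M /minsetP[/andP[Mn0 cM] Mmin] /fintype.subsetP MM0] :
    {M : {set S} | minset (fun M => (M != finset.set0) && closed M) M & M \subset M0}.
  by apply: minset_exists; rewrite cM0 andbT; apply/set0Pn; exists x0.
have {}Mmin (N : {set S}) : N \subset M -> N != finset.set0 -> closed N -> N = M.
  by move=> NM N0 cN; apply: Mmin => //; rewrite N0.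
have /set0Pn[y yM] := Mn0; exists y; first exact: MM0.
pose q x := 1 - hit_prob P pi y x.
have [xm xmM Hxm] : exists2 xm, xm \in M & forall x, x \in M -> q x <= q xm.
  case: (@Order.TotalTheory.arg_maxP _ R S y (mem M) q yM) => z zM Hz.
  by exists z.
have q0 x : 0 <= q x by rewrite subr_ge0 hit_prob_le1.
have mT := step_markov kP hp.
pose f x := if x == y then 0 else q x.
have qf x : q x = step P pi f x.
  rewrite (@markov_ext _ _ _ f (fun z => 1 - (if z == y then 1 else hit_prob P pi y z))).
    by rewrite (markovB (fun=> 1) _ mT) /q hit_prob_fix; case: mT => _ _ ->.
  by move=> z; rewrite /f /q; case: eqP => _; rewrite ?subrr.
rewrite /transient; apply/negP; rewrite -leNgt.
suff : q xm <= 0 by have := Hxm y yM; rewrite /q; lra.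
rewrite leNgt; apply/negP => m0.
pose N := [set x in M | q x == q xm]%SET.
have succ x x' : x \in N -> 0 < p x x' -> (x' != y) && (x' \in N).
  rewrite inE => /andP[xM /eqP qx] px.
  have x'M : x' \in M by move/closedP: cM => /(_ x x'); exact.
  have : f x' = q xm.
    apply: (max_principle (x := x)) => // [z pz|]; last by rewrite -qf qx.
    rewrite /f; case: eqP => // _; apply: Hxm.
    by move/closedP: cM => /(_ x z); exact.
  rewrite /f; case: eqP => [_ E|_ E]; first by move: m0; rewrite -E ltxx.
  by rewrite inE x'M E eqxx.
have NM : N = M.
  apply: Mmin.
  - by apply/fintype.subsetP => x; rewrite inE => /andP[].
  - by apply/set0Pn; exists xm; rewrite inE xmM eqxx.
  - by apply/closedP => x x' xN px; case/andP: (succ x x' xN px).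
have [x' px'] : exists x', 0 < p y x'.
  apply/existsP; apply: contraT; rewrite negb_exists => /forallP H.
  have := p_sum1 y; rewrite big1 => [/eqP|z _]; first by rewrite eq_sym oner_eq0.
  by apply/eqP; rewrite eq_le p_ge0 andbT leNgt H.
have /andP[x'y x'N] := succ y x' (eq_ind_r (fun K : {set S} => y \in K) yM NM) px'.
have : (M :\ y)%SET = M.
  apply: Mmin.
  - exact: subD1set.
  - by apply/set0Pn; exists x'; rewrite !inE x'y -NM.
  - apply/closedP => z z'; rewrite !inE -NM => /andP[_ zN] pz.
    exact: succ z z' zN pz.
by move/setP/(_ y); rewrite !inE eqxx yM.
Qed.

(** By the maximum principle the set where [f] is maximal is closed, so it contains a recurrent
    state. Weak communication says something about such states only. *)
Lemma harmonic_max_recurrent f m x0 : (forall x, step P pi f x = f x) ->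
  (forall x, f x <= m) -> f x0 = m -> exists2 y, f y = m & ~ transient P pi y.
Proof.
move=> fh fm fx0.
have [||y] := @closed_class_recurrent [set x | f x == m]%SET x0.
  by rewrite inE fx0.
  move=> x x'; rewrite !inE => /eqP fx px; apply/eqP.
  by apply: (max_principle (x := x)) => //; rewrite fh fx.
by rewrite inE => /eqP; exists y.
Qed.

End Recurrence.

(** * The average-reward optimality equation of a Blackwell-optimal policy *)

Section OptimalityEquation.
Variables (R : realType) (S A : finType).
Variables (P : S -> A -> S -> R) (r : S -> A -> R) (pi : S -> A -> R).
Hypotheses (kP : is_kernel P) (bw : blackwell_optimal P r pi).

Let rho := gain P r pi.
Let h := bias P r pi.

(** The discounted Bellman inequality times [e], with the Laurent expansion of the value inserted.
    Order 0 in [e] yields the inequality for the gain; where that one is tight, order 1 yields the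
    inequality for the bias. *)
Lemma blackwell_avg_bellman s a : exists K e1 : R, 0 < e1 <= 1 /\
  forall e, 0 < e < e1 ->
  e * r s a + (1 - e) * (avg P s a rho + e * avg P s a h) <= rho s + e * h s + e ^+ 2 * K.
Proof.
case: (bw) => hp _; have [e1 /andP[e10 e11] H] := blackwell_bellman kP bw.
have [_ _ [M HM]] := gain_bias_expansion r kP hp.
exists (2 * `|M|), e1; split=> [|e /andP[ep ee1]]; first by rewrite e10.
have hg : 0 <= 1 - e < 1 by apply/andP; split; lra.
have [|/(_ s a) B _] := H (1 - e); first by apply/andP; split; lra.
set V := disc_value P r pi (1 - e) in B.
pose E x := e * V x - rho x - e * h x.
have EM x : `|E x| <= e ^+ 2 * `|M|.
  have := HM _ hg x; rewrite subKr => /le_trans; apply.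
  by rewrite ler_wpM2l ?sqr_ge0 // ler_norm.
have mT := avg_markov a kP.
have aE : e * avg P s a V = avg P s a rho + e * avg P s a h + avg P s a E.
  rewrite -(markovZ e V mT) -(markovZ e h mT) -!(markovD _ _ mT).
  by congr (avg P s a _); apply/funext => x; rewrite /E; ring.
have := markov_norm mT EM s; have := EM s; rewrite !ler_norml => /andP[_ b1] /andP[b2 _].
have {}B : e * r s a + (1 - e) * (e * avg P s a V) <= e * V s.
  by rewrite [X in _ + X]mulrCA -mulrDr ler_pM2l.
move: B b1; rewrite aE /E; have := mulr_ge0 (sqr_ge0 e) (normr_ge0 M); nra.
Qed.

Lemma blackwell_avg_gain s a : avg P s a rho <= rho s.
Proof.
have [K [e1 [/andP[e10 e11] H]]] := blackwell_avg_bellman s a.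
set x := avg P s a rho in H *; set y := avg P s a h in H.
apply: (@le_of_vanishing_error _ _ _ (`|h s| + `|K| + `|r s a| + `|x| + `|y|) e1) => //.
move=> e /andP[ep ee1]; have := H e; rewrite ep ee1 => /(_ isT).
have e4 : 0 <= e ^+ 2 by exact: sqr_ge0.
have e3 : e ^+ 2 <= e by rewrite expr2; nra.
have q1 : e * h s <= e * `|h s| by rewrite ler_pM2l // ler_norm.
have q2 : e ^+ 2 * K <= e * `|K|.
  by apply: (le_trans (ler_wpM2l e4 (ler_norm K))); exact: ler_wpM2r.
have q3 : - (e * r s a) <= e * `|r s a| by rewrite -mulrN ler_pM2l // -normrN ler_norm.
have q4 : e * x <= e * `|x| by rewrite ler_pM2l // ler_norm.
have q5 : - ((1 - e) * (e * y)) <= e * `|y|.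
  rewrite mulrCA -mulrN ler_pM2l //; apply: (le_trans (ler_norm _)).
  by rewrite normrN normrM ler_piMl // ger0_norm; lra.
by rewrite !mulrDr; lra.
Qed.

Lemma blackwell_bias_bellman s a : avg P s a rho = rho s ->
  r s a + avg P s a h <= rho s + h s.
Proof.
move=> xE; have [K [e1 [/andP[e10 e11] H]]] := blackwell_avg_bellman s a.
rewrite xE in H; set y := avg P s a h in H *.
apply: (@le_of_vanishing_error _ _ _ (K + y) e1) => // e /andP[ep ee1].
have := H e; rewrite ep ee1 => /(_ isT) H'; rewrite -(ler_pM2l ep); lra.
Qed.

Hypothesis r_ge0 : forall s a, 0 <= r s a.

(** Being harmonic under [pi], [rho] attains its maximum and its minimum at recurrent states [y] and
    [z], both in the communicating set. It is also nonnegative and superharmonic under every policy,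
    in particular under one that reaches [y] from [z] almost surely; hence [rho y <= rho z]. *)
Lemma weakly_communicating_gain_cst : weakly_communicating P ->
  forall s s', rho s = rho s'.
Proof.
case: (bw) => hp _ [C [trC comC]].
have rho_h x : step P pi rho x = rho x by have [->] := gain_bias_expansion r kP hp.
suff H s s' : rho s <= rho s' by move=> s s'; apply/eqP; rewrite eq_le !H.
have inC y : ~ transient P pi y -> y \in C.
  by move=> nt; apply/negPn/negP => /trC /(_ pi hp).
have [m Hm] := exists_argmax rho s; have [l Hl] := exists_argmin rho s.
have [y ym /inC yC] := harmonic_max_recurrent kP hp rho_h Hm (erefl _).
have [|||z zl /inC zC] := @harmonic_max_recurrent _ _ _ P pi kP hp (fun x => - rho x) (- rho l) l.
- move=> x; rewrite -rho_h -mulN1r -(markovZ _ _ (step_markov kP hp)).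
  by apply: markov_ext => w; rewrite mulN1r.
- by move=> x; rewrite lerN2.
- by [].
suff : rho y <= rho z.
  move: (Hm s) (Hl s') => H1 H2 H3; apply: (le_trans H1); rewrite -ym.
  by apply: (le_trans H3); rewrite -lerN2 zl lerN2.
case: (eqVneq z y) => [->//|zy].
have [pi' [hp' hit1]] := comC z y zC yC zy.
have := @superharmonic_hit _ _ _ P pi' kP hp' y rho z; rewrite hit1 mulr1; apply.
  move=> x; apply: (le_gain (W := fun=> 0) kP hp) => w.
  rewrite subr0; case: (step_markov kP hp) => _ _ ->; rewrite addr0.
  exact: policy_avg_ge.
by move=> x; apply: policy_avg_le => // a; exact: blackwell_avg_gain.
Qed.

Lemma average_optimality_equation : weakly_communicating P -> (0 < #|S|)%N ->
  exists rho0 : R, [/\ forall s, opt_gain P r s = rho0,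
    forall s, rew_pi r pi s = rho0 + (h s - step P pi h s)
  & forall s a, r s a + avg P s a h <= rho0 + h s].
Proof.
move=> wc /card_gt0P[s0 _]; case: (bw) => hp _.
have cst s : rho s = rho s0 by exact: weakly_communicating_gain_cst.
have [_ E _] := gain_bias_expansion r kP hp.
exists (rho s0); split=> [s|s|s a].
- by rewrite (blackwell_opt_gain kP bw).
- by rewrite E -(cst s).
- rewrite -(cst s); apply: blackwell_bias_bellman.
  have -> : rho = fun=> rho s by apply/funext => x; rewrite !cst.
  by case: (avg_markov a kP) => _ _ ->.
Qed.

End OptimalityEquation.

(** * Concentration of the empirical kernel *)

Section Concentration.
Variables (R : realType) (S A : finType) (n : nat) (P : S -> A -> S -> R).
Hypotheses (kP : is_kernel P) (n_gt0 : (0 < n)%N).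
Implicit Types (w v : outcome S A n) (f : S -> R).

(** [exp (- x / 2) >= 1 - x / 2], and [(1 + x + x^2) (1 - x / 2)^2 = 1 + x^2 (1 - 3 x + x^2) / 4] is
    at least 1 in this range. The 1/4 is the largest span allowed in Bernstein's inequality
    below. *)
Lemma expR_le_quadratic (x : R) : x <= 4^-1 -> expR x <= 1 + x + x ^+ 2.
Proof.
move=> x4; pose u := expR (- (x / 2)).
have uE : expR x * u ^+ 2 = 1.
  by rewrite /u -expRM_natl -expRD -expR0; congr expR; field.
have u1 : 1 - x / 2 <= u by exact: expR_ge1Dx.
have q : (1 - x / 2) ^+ 2 <= u ^+ 2 by apply: lerXn2r => //; rewrite nnegrE; lra.
have p : 0 < (1 - x / 2) ^+ 2 by apply: exprn_gt0; lra.
rewrite -(ler_pM2r p); apply: (@le_trans _ _ 1).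
  by rewrite -[leRHS]uE ler_wpM2l // expR_ge0.
by have := sqr_ge0 x; nra.
Qed.

Lemma outcome_mass_ge0 w : 0 <= outcome_mass P w.
Proof. by case: kP => P0 _; apply: prodr_ge0. Qed.

Lemma sum_outcome_mass : \sum_w outcome_mass (n := n) P w = 1.
Proof.
rewrite /outcome_mass -(bigA_distr_bigA (fun (x : S * A * 'I_n) s' => P x.1.1 x.1.2 s')).
by case: kP => _ P1; rewrite big1.
Qed.

Lemma prob_ge_union (I : finType) (bad : I -> outcome S A n -> Prop)
    (E : outcome S A n -> Prop) (b : R) :
  (forall w, (forall i, ~ bad i w) -> E w) -> (forall i, prob P (bad i) <= b) ->
  1 - #|I|%:R * b <= prob P E.
Proof.
move=> badE probb; rewrite lerBlDr -[leLHS]sum_outcome_mass.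
apply: (@le_trans _ _ (prob P E + \sum_i prob P (bad i))); last first.
  rewrite lerD2l; apply: (le_trans (ler_sum _ (fun i _ => probb i))).
  by rewrite sumr_const mulr_natl.
rewrite /prob [in leRHS]big_mkcond /=.
under [X in _ + X]eq_bigr do rewrite big_mkcond /=.
rewrite exchange_big -big_split /=; apply: ler_sum => w _.
have m0 := outcome_mass_ge0 w.
have t0 i : 0 <= (if `[< bad i w >] then outcome_mass P w else 0) by case: ifP.
case: ifPn => [_|/asboolPn nE]; first by rewrite lerDl; exact: sumr_ge0.
have [i bi] : exists i, bad i w.
  by apply: contra_notP nE => nb; apply: badE => i bi; apply: nb; exists i.
by rewrite add0r (bigD1 i) //= (asboolT bi) lerDl; exact: sumr_ge0.
Qed.

Section Block.
Variable sa : S * A.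

(** Independence of the samples at [sa], expressed as not reading them. *)
Definition block_free (T : Type) (g : outcome S A n -> T) : Prop :=
  forall w v, (forall x, x.1 != sa -> w x = v x) -> g w = g v.

(* Conditioning on the samples outside the block [sa], over which the density
   is a product, leaves [n] independent factors each of mean at most 1. *)
Lemma block_product_mean_le1 (g : outcome S A n -> S -> R) : block_free g ->
  (forall w y, 0 <= g w y) -> (forall w, \sum_y P sa.1 sa.2 y * g w y <= 1) ->
  \sum_w outcome_mass P w * \prod_(i < n) g w (w (sa, i)) <= 1.
Proof.
move=> gfree g0 g1; case: kP => P0 P1.
(* Canonical representative of the outcomes that agree with [w] off the block; the block is filled
   with the arbitrary state [sa.1]. Fibres of [rest] over points it does not fix are empty. *)
pose rest w : outcome S A n := [ffun x => if x.1 == sa then sa.1 else w x].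
have grest w : g w = g (rest w).
  by apply: gfree => x xsa; rewrite ffunE (negbTE xsa).
rewrite -[leRHS]sum_outcome_mass (partition_big rest xpredT) //=.
rewrite [leRHS](partition_big rest xpredT) //=.
apply: ler_sum => v _.
case: (eqVneq (rest v) v) => [vv|nv]; last first.
  have e0 w : (rest w == v) = false.
    apply/eqP => wv; move: nv; rewrite -wv => /eqP; apply.
    by apply/ffunP => x; rewrite !ffunE; case: eqP.
  by rewrite !(eq_bigl _ _ e0) !big_pred0_eq.
pose Q (x : S * A * 'I_n) : pred S := if x.1 == sa then predT else pred1 (v x).
have famE u : (rest u == v) = (u \in family Q).
  apply/idP/idP => [/eqP uv|/familyP H].
    apply/familyP => x; have uvx : rest u x = v x by rewrite uv.
    rewrite /Q; move: uvx; rewrite ffunE; case: eqP => // _ ->.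
    by rewrite inE.
  apply/eqP; rewrite -[RHS]vv; apply/ffunP => x; rewrite !ffunE.
  by have := H x; rewrite /Q /in_mem /=; case: eqP => //= _ /eqP.
rewrite (eq_bigl _ _ famE) [leRHS](eq_bigl _ _ famE).
pose G (x : S * A * 'I_n) y := P x.1.1 x.1.2 y * (if x.1 == sa then g v y else 1).
rewrite (eq_bigr (fun w : outcome S A n => \prod_x G x (w x))); last first.
  move=> w; rewrite -famE => /eqP wv.
  rewrite /outcome_mass /G big_split /=; congr (_ * _).
  rewrite -big_mkcond /= grest wv (reindex_onto (fun i => (sa, i)) snd) /=.
    by apply: eq_bigl => i; rewrite !eqxx.
  by case=> [sa' i] /= /eqP ->.
rewrite /outcome_mass.
rewrite -(bigA_distr_big_dep Q G).
rewrite -(bigA_distr_big_dep Q (fun (x : S * A * 'I_n) y => P x.1.1 x.1.2 y)).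
apply: ler_prod => x _; apply/andP; split.
  by apply: sumr_ge0 => y _; rewrite /G mulr_ge0 //; case: eqP.
rewrite /G /Q; case: eqP => [->|_]; last by apply: ler_sum => y _; rewrite mulr1.
by rewrite P1 g1.
Qed.

End Block.

Definition variance Q (s : S) (a : A) f : R :=
  avg Q s a (fun x => f x ^+ 2) - avg Q s a f ^+ 2.

Lemma avg_Phat w s a f :
  avg (Phat w) s a f = n%:R^-1 * \sum_(i < n) f (w (s, a, i)).
Proof.
rewrite /avg /Phat [in RHS](partition_big (fun i => w (s, a, i)) xpredT) //= mulr_sumr.
apply: eq_bigr => y _; rewrite -mulrA; congr (_ * _).
rewrite (eq_bigr (fun=> f y)); last by move=> i /eqP ->.
rewrite sumr_const mulr_natl; congr (_ *+ _).
by apply: eq_card => i; exact: asboolb.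
Qed.

Lemma Phat_kernel w : is_kernel (Phat (R := R) w).
Proof.
split=> [s a s'|s a]; first by rewrite /Phat mulr_ge0 // invr_ge0.
have := avg_Phat w s a (fun=> 1); rewrite /avg => E.
transitivity (\sum_s' Phat (R := R) w s a s' * 1); first by apply: eq_bigr => y _; rewrite mulr1.
by rewrite E sumr_const card_ord mulVf // pnatr_eq0 -lt0n.
Qed.

(** Let [m] and [V] be the mean and variance of [G] under [P s a]. Then [exp (G - m - V)] has mean
    at most [exp (- V) (1 + V) <= 1], and on the event its product over the [n] samples exceeds
    [exp L]. The free exponent of Chernoff's method is a scaling of [G]. *)
Lemma prob_bernstein s a (G : outcome S A n -> S -> R) (L : R) :
  block_free (s, a) G -> (forall w x y, G w x - G w y <= 4^-1) ->
  prob P (fun w => avg P s a (G w) + variance P s a (G w) + L / n%:R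
                   < avg (Phat w) s a (G w)) <= expR (- L).
Proof.
move=> Gfree Gspan; have mT := avg_markov a kP.
pose g w y := expR (G w y - avg P s a (G w) - variance P s a (G w)).
have g1 w : \sum_y P s a y * g w y <= 1.
  set m := avg P s a (G w); set V := variance P s a (G w).
  have le1 y : g w y <= expR (- V) * (1 + (G w y - m) + (G w y - m) ^+ 2).
    rewrite /g -/m -/V addrC expRD ler_wpM2l ?expR_ge0 // expR_le_quadratic //.
    rewrite lerBlDr addrC -lerBlDr.
    by apply: (markov_ge mT) => x; have := Gspan w y x; lra.
  have -> : \sum_y P s a y * g w y = avg P s a (g w) by [].
  apply: (@le_trans _ _ (avg P s a (fun y => expR (- V) * (1 + (G w y - m) + (G w y - m) ^+ 2)))).
    by case: mT => _ mon _; exact: mon.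
  rewrite (markovZ _ _ mT).
  have -> : avg P s a (fun y => 1 + (G w y - m) + (G w y - m) ^+ 2) = 1 + V.
    rewrite (@markov_ext _ _ (fun f s => avg P s a f) _
      (fun y => (1 - m + m ^+ 2) + ((1 - 2 * m) * G w y + G w y ^+ 2))); last first.
      by move=> y; ring.
    rewrite (markovD (fun=> 1 - m + m ^+ 2) _ mT).
    rewrite (markovD (fun y => (1 - 2 * m) * G w y) _ mT) (markovZ _ _ mT) /V /variance -/m.
    case: mT => _ _ ->; ring.
  rewrite expRN ler_pdivrMl ?expR_gt0 // mulr1; exact: expR_ge1Dx.
have gfree : block_free (s, a) g.
  by move=> w v wv; rewrite /g (Gfree w v wv).
have g0 w y : 0 <= g w y by exact: expR_ge0.
have M := block_product_mean_le1 gfree g0 g1.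
rewrite -[leRHS]mulr1; apply: le_trans (ler_wpM2l (expR_ge0 (- L)) M).
rewrite /prob big_mkcond mulr_sumr; apply: ler_sum => w _.
have m0 := outcome_mass_ge0 w.
have p0 : 0 <= \prod_(i < n) g w (w (s, a, i)) by exact: prodr_ge0.
case: asboolP => [Ew|_]; last by rewrite mulr_ge0 ?expR_ge0 // mulr_ge0.
rewrite mulrCA -{1}[outcome_mass P w]mulr1 ler_wpM2l //.
rewrite /g -expR_sum -expRD -[leLHS]expR0 ler_expR.
have cstE (k : R) : \sum_(i < n) k = n%:R * k by rewrite sumr_const card_ord mulr_natl.
rewrite sumrB sumrB !cstE.
move: Ew; rewrite avg_Phat => Ew.
have np : (0 : R) < n%:R by rewrite ltr0n.
have := ltW Ew; rewrite -(ler_pM2l np) mulVKf ?lt0r_neq0 //.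
have -> : n%:R * (avg P s a (G w) + variance P s a (G w) + L / n%:R) =
  n%:R * avg P s a (G w) + n%:R * variance P s a (G w) + L.
  by field; exact: lt0r_neq0.
lra.
Qed.

End Concentration.

(** * Empirical Bellman inequalities *)

Section Variance.
Variables (R : realType) (S A : finType) (P : S -> A -> S -> R).
Hypothesis kP : is_kernel P.
Variables (s : S) (a : A).
Implicit Types (f g : S -> R).

Let mT := avg_markov a kP.

Lemma avg_cst k : avg P s a (fun=> k) = k.
Proof. by case: mT => _ _ ->. Qed.

Lemma avg_sqrB f m :
  avg P s a (fun y => (f y - m) ^+ 2) = variance P s a f + (avg P s a f - m) ^+ 2.
Proof.
have -> : (fun y => (f y - m) ^+ 2) = (fun y => (- (2 * m) * f y + m ^+ 2) + f y ^+ 2).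
  by apply/funext => y; ring.
rewrite (markovD (fun y => - (2 * m) * f y + m ^+ 2) _ mT).
rewrite (markovD (fun y => - (2 * m) * f y) _ mT) (markovZ _ _ mT) avg_cst.
by rewrite /variance; ring.
Qed.

Lemma variance_ge0 f : 0 <= variance P s a f.
Proof.
have := avg_sqrB f (avg P s a f); rewrite subrr expr0n addr0 => <-.
by apply: (markov_ge mT) => y; exact: sqr_ge0.
Qed.

Lemma variance_le_sqr f k : (forall y, `|f y| <= k) -> variance P s a f <= k ^+ 2.
Proof.
move=> fk; rewrite /variance.
have : avg P s a (fun y => f y ^+ 2) <= k ^+ 2.
  apply: (markov_le mT) => y; rewrite -real_normK ?num_real //.
  by apply: lerXn2r; rewrite ?nnegrE //; exact: le_trans (fk y).
have := sqr_ge0 (avg P s a f); lra.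
Qed.

Lemma variance_scale f k : variance P s a (fun y => k * f y) = k ^+ 2 * variance P s a f.
Proof.
rewrite /variance (markovZ k f mT).
under [X in avg P s a X]eq_fun do rewrite exprMn.
by rewrite (markovZ (k ^+ 2) (fun y => f y ^+ 2) mT); ring.
Qed.

(** Parallelogram identity for the variances of [g + D] and [g - D], where [D = f - g]. *)
Lemma variance_perturb f g e : (forall y, `|f y - g y| <= e) ->
  variance P s a f <= 2 * variance P s a g + 2 * e ^+ 2.
Proof.
move=> fg; pose D y := f y - g y.
have DE := variance_le_sqr fg.
have V0 := variance_ge0 (fun y => g y - D y).
suff E : variance P s a f + variance P s a (fun y => g y - D y) =
    2 * variance P s a g + 2 * variance P s a D by rewrite -/D in DE; lra.
have -> : f = fun y => g y + D y by apply/funext => y; rewrite /D; ring.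
rewrite /variance (markovD g D mT) (markovB g D mT).
have : avg P s a (fun y => (g y + D y) ^+ 2) + avg P s a (fun y => (g y - D y) ^+ 2) =
   2 * avg P s a (fun y => g y ^+ 2) + 2 * avg P s a (fun y => D y ^+ 2).
  rewrite -(markovD _ _ mT) -!(markovZ _ _ mT) -(markovD _ _ mT).
  by congr (avg P s a _); apply/funext => y; ring.
by move=> E; lra.
Qed.

(** With [m] the mean of [f], the variance of [f^2] is at most the mean of
    [(f^2 - m^2)^2 = (f - m)^2 (f + m)^2], and [f + m <= 2 b]. *)
Lemma variance_sqr_le f b : (forall y, 0 <= f y <= b) ->
  variance P s a (fun y => f y ^+ 2) <= 4 * b ^+ 2 * variance P s a f.
Proof.
move=> fb; set m := avg P s a f.
have m0 : 0 <= m by apply: (markov_ge mT) => y; case/andP: (fb y).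
have mb : m <= b by apply: (markov_le mT) => y; case/andP: (fb y).
have := avg_sqrB (fun y => f y ^+ 2) (m ^+ 2).
have := avg_sqrB f m; rewrite -/m subrr expr0n addr0 => <- E.
rewrite -(markovZ _ _ mT).
apply: (@le_trans _ _ (avg P s a (fun y => (f y ^+ 2 - m ^+ 2) ^+ 2))).
  by rewrite E lerDl sqr_ge0.
case: mT => _ mon _; apply: mon => y.
rewrite subr_sqr exprMn mulrC ler_wpM2r ?sqr_ge0 //.
have /andP[f0 fb'] := fb y.
have -> : 4 * b ^+ 2 = (2 * b) ^+ 2 by ring.
by apply: lerXn2r; rewrite ?nnegrE; lra.
Qed.

End Variance.

(** * The MDP with one absorbing state *)

Section Absorbing.
Variables (R : realType) (S A : finType).
Variables (Q : S -> A -> S -> R) (r : S -> A -> R) (gamma : R) (s0 : S).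
Hypotheses (kQ : is_kernel Q) (hg : 0 <= gamma < 1) (cA : (0 < #|A|)%N).

Definition absorb_kernel (Q : S -> A -> S -> R) : S -> A -> S -> R :=
  fun s a s' => if s == s0 then (s' == s0)%:R else Q s a s'.

Definition absorb_reward (k : R) : S -> A -> R :=
  fun s a => if s == s0 then k else r s a.

(* A self-loop at [s0] of reward [(1 - gamma) * u] makes [s0] terminal of value [u]. *)
Definition absorbed_value (Q : S -> A -> S -> R) (u : R) : S -> R :=
  opt_disc_value (absorb_kernel Q) (absorb_reward ((1 - gamma) * u)) gamma.

Lemma absorb_kernelP : is_kernel (absorb_kernel Q).
Proof.
case: kQ => Q0 Q1; split=> [s a s'|s a]; rewrite /absorb_kernel; case: eqP => // _.
by rewrite (bigD1 s0) //= eqxx big1 ?addr0 // => y /negbTE ->.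
Qed.

Lemma avg_absorb s a f : avg (absorb_kernel Q) s a f = if s == s0 then f s0 else avg Q s a f.
Proof.
rewrite /avg /absorb_kernel; case: eqP => // _.
rewrite (bigD1 s0) //= eqxx mul1r big1 ?addr0 // => y /negbTE ->.
by rewrite mul0r.
Qed.

(** For [k = |u - V s0|], the functions [V + k] and [V - k] are a super- and a subsolution of the
    absorbed MDP. *)
Lemma absorbed_value_near u x :
  `|absorbed_value Q u x - opt_disc_value Q r gamma x|
  <= `|u - opt_disc_value Q r gamma s0|.
Proof.
have /card_gt0P[a0 _] := cA; have /andP[g0 g1] := hg.
set V := opt_disc_value Q r gamma; set k := `|u - V s0|.
have k0 : 0 <= k by exact: normr_ge0.
have [d /= [_ VE Vopt]] := opt_disc_value_bellman r kQ hg a0; rewrite -/V in VE Vopt.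
have /andP[k1 k2] : - k <= u - V s0 <= k by rewrite -ler_norml.
have up : absorbed_value Q u x <= V x + k.
  apply: (opt_disc_value_le absorb_kernelP hg cA (W := fun y => V y + k)) => s a.
  rewrite /absorb_reward avg_absorb; case: eqP => [->|_]; first by nra.
  rewrite (markovD V (fun=> k) (avg_markov a kQ)) (avg_cst kQ).
  have := Vopt s a; nra.
have low : V x - k <= absorbed_value Q u x.
  apply: le_trans (disc_value_le_opt (absorb_reward ((1 - gamma) * u)) absorb_kernelP hg cA (det_policyP d) x).
  apply: (le_disc_value absorb_kernelP hg (det_policyP d) (W := fun y => V y - k)) => s.
  rewrite rew_det step_det /absorb_reward avg_absorb.
  case: eqP => [->|_]; first by nra.
  rewrite (markovB V (fun=> k) (avg_markov (d s) kQ)) (avg_cst kQ).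
  have := VE s; nra.
by rewrite ler_norml; apply/andP; split; lra.
Qed.

End Absorbing.

Section Empirical.
Variables (R : realType) (S A : finType).
Variables (P Q : S -> A -> S -> R) (r : S -> A -> R) (gamma : R).
Hypotheses (kP : is_kernel P) (kQ : is_kernel Q) (hg : 0 <= gamma < 1).
Hypothesis hr : forall s a, 0 <= r s a <= 1.

(* The drift of [V + 8 k (V - m)^2] contains [8 k] times the variance of [V],
   which absorbs the variance term of the deviation [(Q - P) V]. *)
Lemma gain_ge_empirical (d : S -> A) (V : S -> R) (m b x k eps : R) :
  0 <= m -> 0 <= b -> (forall s, m <= V s <= m + b) ->
  (forall s, V s <= r s (d s) + gamma * avg Q s (d s) V + eps) ->
  (forall s, `|avg Q s (d s) V - avg P s (d s) V|
             <= 4 * k * variance P s (d s) V + 8 * x) ->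
  0 <= k -> k * (b + 1) = x -> 16 * x <= 1 -> 0 <= eps <= x ->
  forall s, (1 - gamma) * m - 49 * x <= gain P r (det_policy d) s.
Proof.
move=> m0 b0 mVb Vsub dev k0 kx x1 /andP[e0 ex].
apply: (le_gain (W := fun y => V y + 8 * k * (V y - m) ^+ 2) kP (det_policyP d)) => s.
rewrite rew_det step_det; set a := d s; have mT := avg_markov a kP.
have /andP[g0 g1] := hg; have /andP[r0 r1] := hr s a.
rewrite (markovD V _ mT) (markovZ _ _ mT) (avg_sqrB kP).
have D0 := variance_ge0 kP s a V.
have pm : m <= avg P s a V by apply: (markov_ge mT) => y; case/andP: (mVb y).
have := dev s; rewrite -/a; have := Vsub s; rewrite -/a.
have /andP[Vm Vb] := mVb s.
set p := avg P s a V in pm *; set q := avg Q s a V; set D := variance P s a V in D0 *.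
have := ler_norm (q - p); have := normr_ge0 (q - p); set E := `|q - p| => E0 qp Vq ED.
have gq : gamma * q <= gamma * p + E by nra.
have gm : (1 - gamma) * m <= (1 - gamma) * p by rewrite ler_wpM2l //; lra.
have gm0 : 0 <= (1 - gamma) * m by rewrite mulr_ge0 //; lra.
(* [t] is the drift of [V], at least [-(1 + E + eps)] because rewards are at most 1. The square
   contributes [8 k D], the cross term [16 k v t] and a nonnegative [t^2]. As [16 k b <= 1], the
   cross term costs at most [32 x + E]; in total [2 E <= 8 k D + 16 x] is to be paid, and 49 = 16 +
   32 + 1, the 1 being [eps]. *)
pose t := p - V s; pose v := V s - m.
have t1 : - (1 + E + eps) <= t by rewrite /t; lra.
have vt : - (b * (1 + E + eps)) <= v * t.
  have [v0 vb] : 0 <= v /\ v <= b by rewrite /v; split; lra.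
  apply: (@le_trans _ _ (v * - (1 + E + eps))); last exact: ler_wpM2l.
  by rewrite mulrN lerN2 ler_wpM2r //; lra.
have -> : (p - m) ^+ 2 = v ^+ 2 + 2 * (v * t) + t ^+ 2 by rewrite /v /t; ring.
have t2 := mulr_ge0 k0 (sqr_ge0 t).
have kvt : - (k * b * (1 + E + eps)) <= k * (v * t).
  by rewrite -mulrA -mulrN ler_wpM2l.
have kb : k * b <= x by lra.
have kb0 : 0 <= k * b by exact: mulr_ge0.
have kbE : 16 * (k * b) * E <= E by rewrite ler_piMl //; lra.
have kbe : k * b * (1 + eps) <= 2 * x.
  by have := ler_pM kb0 (_ : 0 <= 1 + eps) kb (_ : 1 + eps <= 2); rewrite mulrC; lra.
rewrite -/v; rewrite /t in t2 kvt *.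
have : k * b * (1 + E + eps) = k * b * (1 + eps) + k * b * E by ring.
lra.
Qed.

Section ValueBounds.
Variables (pi : S -> A -> R) (rho : R) (h : S -> R) (m b x lam y : R).
Hypotheses (hp : is_policy pi) (cA : (0 < #|A|)%N).
Hypothesis rho_ge0 : 0 <= rho <= 1.
Hypothesis h_eq : forall s, rew_pi r pi s = rho + (h s - step P pi h s).
Hypothesis h_opt : forall s a, r s a + avg P s a h <= rho + h s.
Let v s := h s - m.
Hypotheses (b_ge0 : 0 <= b) (vb : forall s, 0 <= v s <= b).
Hypothesis dev1 : forall s a,
  `|avg Q s a v - avg P s a v| <= lam * variance P s a v + x.
Hypothesis dev2 : forall s a,
  `|avg Q s a (fun s => v s ^+ 2) - avg P s a (fun s => v s ^+ 2)|
  <= 2^-1 * variance P s a v + 8 * y.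
Hypotheses (lam_ge0 : 0 <= lam) (lamb : lam * (b + 1) = x) (x4 : 4 * x <= 1).
Hypotheses (y_ge0 : 0 <= y) (lamy : lam * y <= x).

Let V := opt_disc_value Q r gamma.
Let lb0 : 0 <= lam * b. Proof. exact: mulr_ge0. Qed.
Let lbx : lam * b <= x. Proof. by move: lamb lam_ge0; lra. Qed.
Let lvv s : 0 <= lam * v s ^+ 2 <= x * b.
Proof.
have /andP[v0 v1] := vb s; rewrite mulr_ge0 ?sqr_ge0 //= expr2 mulrA.
by apply: ler_pM => //; [exact: mulr_ge0|apply: le_trans lbx; exact: ler_wpM2l].
Qed.

Let x_ge0 : 0 <= x. Proof. exact: le_trans lbx. Qed.
Let x_le : x <= 4^-1. Proof. by move: x4; lra. Qed.
Let xb_le : x * b <= b / 4. Proof. by rewrite mulrC ler_wpM2l. Qed.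
Let lv_le s : 2 * (lam * v s ^+ 2) <= 2 * (b / 4).
Proof. by rewrite ler_pM2l //; apply: le_trans xb_le; case/andP: (lvv s). Qed.

Let avg_v s a : avg P s a v = avg P s a h - m.
Proof. by rewrite (markovB h (fun=> m) (avg_markov a kP)) (avg_cst kP). Qed.

Let p_bounds s a : 0 <= avg P s a v <= b.
Proof.
apply/andP; split.
  by apply: (markov_ge (avg_markov a kP)) => z; case/andP: (vb z).
by apply: (markov_le (avg_markov a kP)) => z; case/andP: (vb z).
Qed.

(* [K + v - 2 lam v^2] is a supersolution of the empirical Bellman equation. *)
Lemma opt_disc_value_upper s :
  V s <= (rho + 21 * x) / (1 - gamma) + 2 * b.
Proof.
have /andP[g0 g1] := hg; have g1p : 0 < 1 - gamma by lra.
have [lam_b lam_b0 x0 xb] := And4 lbx lb0 x_ge0 xb_le.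
have [lam0 y0 lam_y b0] := And4 lam_ge0 y_ge0 lamy b_ge0.
pose K := (rho + 21 * x) / (1 - gamma) + b.
apply: (@le_trans _ _ (K + v s - 2 * lam * v s ^+ 2)); last first.
  by have /andP[_ ?] := vb s; have /andP[? _] := lvv s; rewrite /K; lra.
move: s; apply: (opt_disc_value_le kQ hg cA) => s a.
have KE : (1 - gamma) * K = rho + 21 * x + (1 - gamma) * b.
  by rewrite /K mulrDr; congr (_ + _); field; lra.
have mT := avg_markov a kQ.
rewrite (markovB (fun z => K + v z) _ mT) (markovZ _ _ mT) (markovD (fun=> K) _ mT).
rewrite (avg_cst kQ).
have := variance_ge0 kP s a v; have := dev1 s a; have := dev2 s a.
have := h_opt s a; have := avg_v s a; have := p_bounds s a.
have /andP[r0 r1] := hr s a; have /andP[v0 v1] := vb s; have /andP[w0 w1] := lvv s.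
have : avg P s a (fun z => v z ^+ 2) = variance P s a v + avg P s a v ^+ 2.
  by rewrite /variance subrK.
set D := variance P s a v; set p := avg P s a v; set q := avg Q s a v.
set p2 := avg P s a _; set q2 := avg Q s a _.
move=> -> /andP[p0 pb] pE hE; rewrite !ler_norml => /andP[E2 _] /andP[_ E1] D0.
have [rho0 rho1] := andP rho_ge0.
(* The suboptimality gap of [a]: the drift of [v] is bounded below only by [-(1 + Del)]. In the
   cross term the gap costs at most [4 lam b Del <= Del], which the reward, smaller by [Del],
   compensates. The errors add up to 21 = 1 + 16 + 4. *)
pose Del := rho + v s - p - r s a.
have Del0 : 0 <= Del by rewrite /Del /v pE; lra.
have lq2 : lam * (D / 2 - 8 * y + p ^+ 2) <= lam * q2 by rewrite ler_wpM2l //; lra.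
have tan : v s ^+ 2 + 2 * (v s * (p - v s)) <= p ^+ 2.
  by have := sqr_ge0 (p - v s); lra.
have vDel : - (b * (1 + Del)) <= v s * (p - v s).
  apply: (@le_trans _ _ (v s * - (1 + Del))); last by rewrite ler_wpM2l // /Del; lra.
  by rewrite mulrN lerN2 ler_wpM2r //; lra.
have lvDel : - (lam * b * (1 + Del)) <= lam * (v s * (p - v s)).
  by rewrite -mulrA -mulrN ler_wpM2l.
have ltan : lam * (v s ^+ 2 + 2 * (v s * (p - v s))) <= lam * p ^+ 2 by rewrite ler_wpM2l.
have lam_b4 : lam * b <= 4^-1 by exact: le_trans lam_b x_le.
have lbDel : lam * b * Del <= 4^-1 * Del by rewrite ler_wpM2r.
have lq2' : lam * D / 2 - 8 * x + lam * v s ^+ 2 - 2 * x - Del / 2 <= lam * q2 by lra.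
have main : r s a + q - 2 * (lam * q2) + 2 * (lam * v s ^+ 2) <= rho + v s + 21 * x.
  have rE : r s a = rho + v s - p - Del by rewrite /Del; ring.
  lra.
have g_main := ler_wpM2l g0 main.
have r_main : (1 - gamma) * (r s a) <= (1 - gamma) * (rho + v s).
  apply: ler_wpM2l; first exact: ltW.
  have -> : rho + v s = r s a + (p + Del) by rewrite /Del; ring.
  by rewrite lerDl addr_ge0.
have w_main := ler_wpM2l (ltW g1p) (lv_le s).
have gx : gamma * (21 * x) <= 21 * x by rewrite ler_piMl ?mulr_ge0 // ltW.
have gb : 0 <= (1 - gamma) * b by rewrite mulr_ge0 // ltW.
lra.
Qed.

(** [K + v + 2 lam v^2] is a subsolution for [pi]: the square now enters with a plus sign, to supply
    variance. The Poisson equation of [pi] is an equality, so no gap arises. The [2 b] in [K] covers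
    what discounting takes from [v], at most [b], and from the square, at most [b / 2], per unit of
    [1 - gamma]. *)
Lemma opt_disc_value_lower s :
  (rho - 21 * x) / (1 - gamma) - 2 * b <= V s.
Proof.
have /andP[g0 g1] := hg; have g1p : 0 < 1 - gamma by lra.
have [lam_b lam_b0 x0 xb] := And4 lbx lb0 x_ge0 xb_le.
have [lam0 y0 lam_y b0] := And4 lam_ge0 y_ge0 lamy b_ge0.
pose K := (rho - 21 * x) / (1 - gamma) - 2 * b.
apply: (@le_trans _ _ (K + v s + 2 * lam * v s ^+ 2)).
  by have /andP[? _] := vb s; have /andP[? _] := lvv s; rewrite -/K; lra.
apply: le_trans (disc_value_le_opt r kQ hg cA hp s).
move: s; apply: (le_disc_value kQ hg hp) => s.
have KE : (1 - gamma) * K = rho - 21 * x - (1 - gamma) * (2 * b).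
  by rewrite /K mulrBr; congr (_ - _); field; lra.
have [rho0 rho1] := andP rho_ge0.
have /andP[v0 v1] := vb s; have /andP[w0 w1] := lvv s.
(* Affine in [r s a] and [avg P s a v], hence stable under averaging over [pi]. *)
pose low a := r s a + gamma * (K + avg P s a v - x)
  + 2 * gamma * (lam * (2 * v s * avg P s a v - v s ^+ 2) - 8 * x).
have lowP a : low a <= r s a + gamma * avg Q s a (fun z => K + v z + 2 * lam * v z ^+ 2).
  have mT := avg_markov a kQ.
  rewrite (markovD (fun z => K + v z) _ mT) (markovZ _ _ mT) (markovD (fun=> K) _ mT).
  rewrite (avg_cst kQ) /low -addrA lerD2l.
  have := variance_ge0 kP s a v; have := dev1 s a; have := dev2 s a.
  have : avg P s a (fun z => v z ^+ 2) = variance P s a v + avg P s a v ^+ 2.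
    by rewrite /variance subrK.
  set D := variance P s a v; set p := avg P s a v; set q := avg Q s a v.
  set p2 := avg P s a _; set q2 := avg Q s a _.
  move=> ->; rewrite !ler_norml => /andP[E2 _] /andP[E1 _] D0.
  have lq2 : lam * (D / 2 - 8 * y + p ^+ 2) <= lam * q2 by rewrite ler_wpM2l //; lra.
  have ltan : lam * (2 * v s * p - v s ^+ 2) <= lam * p ^+ 2.
    by rewrite ler_wpM2l //; have := sqr_ge0 (p - v s); lra.
  rewrite -(mulrA 2 gamma) -(mulrCA gamma) -mulrDr ler_wpM2l //; lra.
rewrite backup_policy.
apply: (@le_trans _ _ (\sum_a pi s a * low a)); last first.
  by case: hp => p0 _; apply: ler_sum => a _; exact: ler_wpM2l.
have step_v : step P pi v s = step P pi h s - m.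
  have mp := step_markov kP hp.
  by rewrite (markovB h (fun=> m) mp); case: mp => _ _ ->.
pose c0 := gamma * (K - x) - 2 * gamma * (lam * v s ^+ 2 + 8 * x).
pose c1 := gamma + 4 * gamma * lam * v s.
have -> : \sum_a pi s a * low a = rew_pi r pi s + c1 * step P pi v s + c0.
  have c0E : c0 = \sum_a pi s a * c0 by case: hp => _ p1; rewrite -mulr_suml p1 mul1r.
  rewrite [X in _ + X]c0E stepE /rew_pi mulr_sumr -!big_split /=.
  by apply: eq_bigr => a _; rewrite /low /c0 /c1; ring.
have pv0 : 0 <= step P pi v s <= b.
  have mp := step_markov kP hp; apply/andP; split.
    by apply: (markov_ge mp) => z; case/andP: (vb z).
  by apply: (markov_le mp) => z; case/andP: (vb z).
have rr : 0 <= rew_pi r pi s <= 1.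
  apply/andP; split; first by apply: policy_avg_ge => // a; case/andP: (hr s a).
  by apply: policy_avg_le => // a; case/andP: (hr s a).
have := h_eq s; move: pv0 rr; set p := step P pi v s in step_v *.
set rp := rew_pi r pi s => /andP[p0 pb] /andP[rp0 rp1] rpE.
have rE : rp = rho + v s - p by rewrite rpE step_v /v; ring.
have vt : - b <= v s * (p - v s).
  apply: (@le_trans _ _ (v s * - 1)); last by rewrite ler_wpM2l //; lra.
  by rewrite mulrN1 lerN2.
have lvt : - x <= lam * (v s * (p - v s)).
  by have := ler_wpM2l lam_ge0 vt; rewrite mulrN; lra.
have g_lvt := ler_wpM2l g0 lvt.
have w_main := ler_wpM2l (ltW g1p) (lv_le s).
have p_main := ler_wpM2l (ltW g1p) pb.
have gx : gamma * x <= x by rewrite ler_piMl // ltW.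
have gb : 0 <= (1 - gamma) * b by rewrite mulr_ge0 // ltW.
rewrite /c0 /c1 rE; lra.
Qed.

End ValueBounds.
End Empirical.

(** * Deviation bounds and the good event *)

Section Span.
Variables (R : realType) (S : finType) (s0 : S).
Implicit Types (f g : S -> R).

Lemma vminP f : exists2 s, vmin f = f s & forall x, f s <= f x.
Proof.
have [s Hs] := exists_argmin f s0; exists s => //.
apply/eqP; rewrite eq_le; apply/andP; split.
  by apply: ge_inf; [exists (f s) => _ [x _ <-]|exists s].
by apply: lb_le_inf; [exists (f s), s|move=> _ [x _ <-]].
Qed.

Lemma vmaxP f : exists2 s, vmax f = f s & forall x, f x <= f s.
Proof.
have [s Hs] := exists_argmax f s0; exists s => //.
apply/eqP; rewrite eq_le; apply/andP; split.
  by apply: ge_sup; [exists (f s), s|move=> _ [x _ <-]].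
by apply: ub_le_sup; [exists (f s) => _ [x _ <-]|exists s].
Qed.

Lemma vmin_le f x : vmin f <= f x.
Proof. by have [s ->] := vminP f. Qed.

Lemma vmin_ge f k : (forall x, k <= f x) -> k <= vmin f.
Proof. by move=> H; have [s -> _] := vminP f. Qed.

Lemma le_vmin_spnorm f x : f x <= vmin f + spnorm f.
Proof. by rewrite /spnorm addrC subrK; have [s ->] := vmaxP f. Qed.

Lemma spnorm_le f lo hi : (forall x, lo <= f x <= hi) -> spnorm f <= hi - lo.
Proof.
move=> H; rewrite /spnorm; have [s -> _] := vminP f; have [s' -> _] := vmaxP f.
by have /andP[h1 h2] := H s; have /andP[h3 h4] := H s'; lra.
Qed.

Lemma spnorm_ge0 f : 0 <= spnorm f.
Proof. by have := vmin_le f s0; have := le_vmin_spnorm f s0; lra. Qed.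

Lemma diff_le_spnorm f x x' : f x - f x' <= spnorm f.
Proof. by have := vmin_le f x'; have := le_vmin_spnorm f x; lra. Qed.

Lemma spnorm_near f g e : (forall x, `|f x - g x| <= e) ->
  spnorm f <= spnorm g + 2 * e.
Proof.
move=> fg; have -> : spnorm g + 2 * e = (vmin g + spnorm g + e) - (vmin g - e) by ring.
apply: spnorm_le => x; have := fg x; rewrite ler_norml => /andP[h1 h2].
by have := vmin_le g x; have := le_vmin_spnorm g x; move=> *; apply/andP; split; lra.
Qed.

End Span.

Section Numerics.
Variable R : realType.

Lemma exists_pow2 (z : R) : 1 <= z -> exists k : nat, z <= 2 ^+ k <= 2 * z.
Proof.
move=> z1; have [k zk] : exists k : nat, z <= 2 ^+ k.
  exists (Num.truncn z).+1; apply: (le_trans (ltW (truncnS_gt z))).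
  by rewrite -natrX ler_nat ltnW // ltn_expl.
elim: k zk => [|k IH] zk; first by exists 0%N; rewrite zk /= expr0; lra.
case: (leP z (2 ^+ k)) => [|zk']; first exact: IH.
by exists k.+1; rewrite zk /= exprS; lra.
Qed.

Lemma log2_log2_ge1 (x : R) : 4 <= x -> 1 <= log2 (log2 x).
Proof.
move=> x4; have l2 : 0 < ln (2 : R) by apply: ln_gt0; lra.
have log2_ge (k : nat) (z : R) : 2 ^+ k <= z -> k%:R <= log2 z.
  move=> kz; rewrite /log2 ler_pdivlMr // mulr_natl -lnXn //.
  by rewrite ler_ln // posrE; [|apply: lt_le_trans kz]; exact: exprn_gt0.
apply: (log2_ge 1%N); rewrite expr1; apply: (log2_ge 2%N).
by rewrite expr2; lra.
Qed.

Lemma one_le_ln (x : R) : 4 <= x -> 1 <= ln x.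
Proof.
move=> x4; rewrite -ler_expR lnK ?posrE; last by lra.
apply: le_trans x4; have : 1 - 2^-1 <= expR (- 2^-1 : R) by exact: expR_ge1Dx.
have : expR 1 * expR (- 2^-1 : R) ^+ 2 = 1.
  by rewrite -expRM_natl -expRD -[RHS]expR0; congr expR; field.
have := expR_gt0 (1 : R); set u := expR (- 2^-1); set e := expR 1 => e0 eu u1.
have u2 : (1 - 2^-1) ^+ 2 <= u ^+ 2 by apply: lerXn2r; rewrite ?nnegrE; lra.
by have := ler_wpM2l (ltW e0) u2; rewrite eu; lra.
Qed.

(** Here [q = sqrt L], [y = sqrt ((b + 1) / n)], [z = sqrt (n (b + 1))], [e = 1 / n] and [H] is the
    horizon. The left side is at most [(84 q + 6) (b + 1)], which fits under the 96 of [alpha]. *)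
Lemma score_radius_bound (al q x y b H z e sp : R) :
  1 <= q -> 96 * q <= al -> x = q * y -> 0 <= y -> 0 <= b -> y * z = b + 1 ->
  H <= 2 * z -> 0 <= e <= 1 -> sp <= 42 * (x * H) + 4 * b + 2 * e ->
  sp + 3 * e + 1 <= al ^+ 2 * (b + 1).
Proof.
move=> q1 qal xE y0 b0 yz Hz /andP[e0 e1] spb.
have qy : 0 <= q * y by apply: mulr_ge0 => //; lra.
have xH : x * H <= 2 * (q * (b + 1)).
  have := ler_wpM2l qy Hz; rewrite xE -yz; clear; lra.
have b1 : 0 <= b + 1 by lra.
have al1 : 0 <= al - 1 by clear -q1 qal; lra.
have t1 := ler_wpM2r b1 qal; have t2 := ler_wpM2r b1 q1.
have t3 : al * (b + 1) <= al ^+ 2 * (b + 1).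
  by rewrite ler_wpM2r // expr2; clear -al1; nra.
by clear -spb xH t1 t2 t3 e0 e1 b0; lra.
Qed.

(** Same notation, with [g = 1 / H]. While [H <= 2 z] controls the span, [z <= H] is what makes the
    discounting error [g b] at most [y]. One [al^2 y] absorbs [21 x + 2 y + 3 e], the other is the
    radius. *)
Lemma score_center_bound (al x y b H z g e rho m mo : R) :
  96 <= al -> 96 * x <= al * y -> 0 <= y -> y * z = b + 1 -> z <= H ->
  g * H = 1 -> 0 < g <= 1 -> 0 <= e <= y ->
  (rho - 21 * x) * H - 2 * b <= m -> m - e <= mo ->
  rho - 2 * al ^+ 2 * y <= g * mo - 2 * (g * e) - al ^+ 2 * y.
Proof.
move=> al96 xal y0 yz zH gH /andP[g0 g1] /andP[e0 ey] mH mo_m.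
have gb : g * (b + 1) <= y.
  rewrite -yz -[leRHS]mulr1 -gH [leRHS]mulrCA ler_pM2l //.
  exact: ler_wpM2l.
have gm := ler_wpM2l (ltW g0) mH; have gmo := ler_wpM2l (ltW g0) mo_m.
have ge : g * e <= e by rewrite ler_piMl.
have E1 : g * ((rho - 21 * x) * H - 2 * b) = rho - 21 * x - 2 * (g * b).
  by rewrite mulrBr mulrCA gH; ring.
have ay : 96 * y <= al * y by exact: ler_wpM2r.
have aay : 96 * (al * y) <= al ^+ 2 * y.
  by rewrite expr2 -[leRHS]mulrA; apply: ler_wpM2r => //; apply: mulr_ge0 => //; clear -al96; lra.
rewrite E1 in gm; clear -gb gm gmo ge ay aay xal ey y0 g0; lra.
Qed.

End Numerics.

Section Deviations.
Variables (R : realType) (S A : finType) (P : S -> A -> S -> R) (n : nat) (L : R).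
Hypotheses (kP : is_kernel P) (n_gt0 : (0 < n)%N).
Implicit Types (w v : outcome S A n) (f : S -> R).

(** The sign [b] gives the two one-sided events; [lam] trades the variance term against [L / n]. *)
Definition deviates w s a (lam : R) f (b : bool) : Prop :=
  let G := fun y => (-1) ^+ b * (lam * f y) in
  avg P s a G + variance P s a G + L / n%:R < avg (Phat w) s a G.

Lemma prob_deviates s a (lam : outcome S A n -> R) (f : outcome S A n -> S -> R) b :
  block_free (s, a) lam -> block_free (s, a) f ->
  (forall w x y, lam w * (f w x - f w y) <= 4^-1) ->
  prob P (fun w => deviates w s a (lam w) (f w) b) <= expR (- L).
Proof.
move=> lamfree ffree span.
apply: (prob_bernstein kP n_gt0 L (G := fun w y => (-1) ^+ b * (lam w * f w y))).
  by move=> w v wv; rewrite (lamfree w v wv) (ffree w v wv).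
move=> w x y; have := span w x y; have := span w y x.
by case: b; rewrite ?expr1 ?expr0; lra.
Qed.

Lemma deviation_le w s a lam f : 0 < lam -> (forall b, ~ deviates w s a lam f b) ->
  `|avg (Phat w) s a f - avg P s a f| <= lam * variance P s a f + L / n%:R / lam.
Proof.
move=> lam0 nd; have mP := avg_markov a kP.
have mQ := avg_markov a (Phat_kernel R n_gt0 w).
have H (b : bool) : (-1) ^+ b * (avg (Phat w) s a f - avg P s a f)
    <= lam * variance P s a f + L / n%:R / lam.
  have /negP := nd b; rewrite /deviates -leNgt.
  rewrite (markovZ _ (fun y => lam * f y) mP) (markovZ _ (fun y => lam * f y) mQ).
  rewrite (markovZ _ f mP) (markovZ _ f mQ).
  rewrite (variance_scale kP s a (fun y => lam * f y)) (variance_scale kP) sqrr_sign mul1r.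
  move=> dev_b; rewrite -(ler_pM2l lam0).
  have -> : lam * (lam * variance P s a f + L / n%:R / lam) =
    lam ^+ 2 * variance P s a f + L / n%:R by rewrite mulrDr [L / _ / _]mulrC mulVKf ?lt0r_neq0 //; ring.
  by lra.
have := H true; have := H false; rewrite expr0 expr1 ler_norml.
by move=> h1 h2; apply/andP; split; lra.
Qed.

Lemma Phat_block w v s a y : (forall i, w (s, a, i) = v (s, a, i)) ->
  Phat (R := R) w s a y = Phat v s a y.
Proof.
move=> wv; have E (u : outcome S A n) :
    Phat u s a y = avg (Phat (R := R) u) s a (fun z => (z == y)%:R).
  rewrite /avg (bigD1 y) //= eqxx mulr1 big1 ?addr0 // => z /negbTE ->.
  by rewrite mulr0.
by rewrite !E !avg_Phat; under eq_bigr do rewrite wv.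
Qed.

(** The rows of the kernel at [s] are overwritten, and the others are built from samples outside the
    block. *)
Lemma absorbed_value_block_free (r : S -> A -> R) gamma s a u :
  block_free (s, a) (fun w => absorbed_value r gamma s (Phat w) u).
Proof.
move=> w v wv; rewrite /absorbed_value.
have -> // : absorb_kernel s (Phat (R := R) w) = absorb_kernel s (Phat v).
apply/funext => x; apply/funext => b; apply/funext => y; rewrite /absorb_kernel.
case: eqP => // xs; apply: Phat_block => i; apply: wv.
by apply/eqP => -[].
Qed.

(* Weight of the exponential moment, tuned to the span [b] of the function;
   it is set to 0 where Bernstein's inequality is not available. *)
Definition scale (c b : R) : R :=
  if c * Num.sqrt (b + 1) <= 4^-1 then c / Num.sqrt (b + 1) else 0.

Lemma scale_span c b f x y : 0 <= c -> 0 <= b -> f x - f y <= b ->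
  scale c b * (f x - f y) <= 4^-1.
Proof.
move=> c0 b0 fb; rewrite /scale; case: ifP => [cb|_]; last by rewrite mul0r.
have q0 : 0 < Num.sqrt (b + 1) by rewrite sqrtr_gt0; lra.
apply: le_trans cb; rewrite -mulrA ler_wpM2l // mulrC ler_pdivrMr //.
by rewrite -expr2 sqr_sqrtr; lra.
Qed.

Lemma deviation_scale_le w s a f c b : 0 < c -> c ^+ 2 = L / n%:R -> 0 <= b ->
  c * Num.sqrt (b + 1) <= 4^-1 -> (forall e, ~ deviates w s a (scale c b) f e) ->
  `|avg (Phat w) s a f - avg P s a f|
  <= c / Num.sqrt (b + 1) * variance P s a f + c * Num.sqrt (b + 1).
Proof.
move=> c0 cL b0 cb; rewrite /scale cb => nd.
have q0 : 0 < Num.sqrt (b + 1) by rewrite sqrtr_gt0; lra.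
apply: le_trans (deviation_le _ nd) _; first exact: divr_gt0.
rewrite lerD2l -cL le_eqVlt; apply/orP; left; apply/eqP; field.
by apply/andP; split; exact: lt0r_neq0.
Qed.

End Deviations.

(** The square roots for [F] and [V] agree up to a factor 2, and the variance of [F] is at most
    twice that of [V] plus [2 eps^2]: hence 4. The remainder is 8 = 2 + 4 + 2, from [c qF], from
    [eps^2], and from replacing [F] by [V] in both averages. *)
Lemma deviation_proxy (R : realType) (S A : finType) (P Q : S -> A -> S -> R) s a
    (V F : S -> R) c eps (s0 : S) : is_kernel P -> is_kernel Q -> 0 < c -> 0 <= eps <= c ^+ 2 -> eps <= 1 ->
  (forall y, `|F y - V y| <= eps) ->
  let x := c * Num.sqrt (spnorm V + 1) in 16 * x <= 1 ->
  (c * Num.sqrt (spnorm F + 1) <= 4^-1 ->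
    `|avg Q s a F - avg P s a F|
    <= c / Num.sqrt (spnorm F + 1) * variance P s a F + c * Num.sqrt (spnorm F + 1)) ->
  `|avg Q s a V - avg P s a V|
  <= 4 * (c / Num.sqrt (spnorm V + 1)) * variance P s a V + 8 * x.
Proof.
move=> kP kQ c0 /andP[e0 ec] e1 FV x x16 devF.
set bV := spnorm V in x x16 *; set bF := spnorm F in devF.
have bV0 : 0 <= bV by exact: spnorm_ge0.
have bF0 : 0 <= bF by exact: spnorm_ge0.
have FV' : forall y, `|V y - F y| <= eps by move=> y; rewrite distrC.
have near1 : bF <= bV + 2 * eps := spnorm_near s0 FV.
have near2 : bV <= bF + 2 * eps := spnorm_near s0 FV'.
set qV := Num.sqrt (bV + 1) in x x16 *; set qF := Num.sqrt (bF + 1) in devF.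
have two4 : (2 : R) = Num.sqrt 4 by rewrite (_ : 4 = 2 ^+ 2); [rewrite sqrtr_sqr ger0_norm|ring].
have qFV : qF <= 2 * qV.
  by rewrite two4 -sqrtrM // ler_sqrt; clear -near1 near2 bV0 bF0 e1 e0; lra.
have qVF : qV <= 2 * qF.
  by rewrite two4 -sqrtrM // ler_sqrt; clear -near1 near2 bV0 bF0 e1 e0; lra.
have qV1 : 1 <= qV by rewrite -[leLHS]sqrtr1 ler_sqrt; clear -bV0; lra.
have qV0 : 0 < qV by exact: lt_le_trans qV1.
have qF0 : 0 < qF by rewrite sqrtr_gt0; clear -bF0; lra.
have cqF : c * qF <= 2 * x by rewrite /x mulrCA ler_pM2l.
have {}devF : `|avg Q s a F - avg P s a F| <= c / qF * variance P s a F + c * qF.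
  by apply: devF; clear -cqF x16; lra.
have aF (M : S -> A -> S -> R) : is_kernel M -> `|avg M s a V - avg M s a F| <= eps.
  move=> kM; rewrite -(markovB V F (avg_markov a kM)).
  exact: (markov_norm (avg_markov a kM) FV').
have vF := variance_perturb kP s a FV.
have v0' := variance_ge0 kP s a F.
set k := c / qV; have k0 : 0 <= k by rewrite divr_ge0 ?ltW.
have kF : c / qF <= 2 * k.
  by rewrite /k ler_pdivrMr // mulrA mulrAC ler_pdivlMr //; clear -c0 qVF; nra.
have kx : k <= x.
  have qV2 : 1 <= qV * qV by rewrite -expr2 exprn_ege1.
  by rewrite /k /x ler_pdivrMr // -mulrA -[leLHS]mulr1 ler_pM2l.
have cx : c <= x by rewrite -[leLHS]mulr1 /x ler_pM2l.
have x0 : 0 <= x by exact: le_trans kx.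
have ex : eps <= x.
  apply: (le_trans ec); rewrite expr2 /x ler_pM2l //.
  by clear -cx x16 x0 qV1; lra.
have t1 : c / qF * variance P s a F <= 2 * k * (2 * variance P s a V + 2 * eps ^+ 2).
  by apply: ler_pM => //; rewrite divr_ge0 ?ltW.
have t2 : k * eps ^+ 2 <= x.
  by rewrite -[leRHS]mulr1; apply: ler_pM => //; [exact: sqr_ge0|rewrite expr_le1].
have := aF _ kP; have := aF _ kQ; move: devF.
clear -t1 t2 cqF ex.
rewrite !ler_norml => /andP[d1 d2] /andP[d3 d4] /andP[d5 d6].
by apply/andP; split; lra.
Qed.

Section GoodEvent.
Variables (R : realType) (S A : finType) (P : S -> A -> S -> R) (r : S -> A -> R).
Variables (delta : R) (n : nat) (h : S -> R).
Hypotheses (cS : (0 < #|S|)%N) (cA : (0 < #|A|)%N) (kP : is_kernel P).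
Hypotheses (hr : forall s a, 0 <= r s a <= 1) (hd : 0 < delta < 1) (n_gt0 : (0 < n)%N).

Let N : R := 24 * #|S|%:R * #|A|%:R * n%:R ^+ 5.
Let L := ln (N / delta).
Let c := Num.sqrt (L / n%:R).

Let card_ge1 : [/\ (1 : R) <= #|S|%:R, (1 : R) <= #|A|%:R & (1 : R) <= n%:R].
Proof. by rewrite !ler1n. Qed.

Let N_ge24 : 24 <= N.
Proof.
have [s1 a1 n1] := card_ge1; rewrite /N -!mulrA ler_peMr //.
have n5 : 1 <= (n%:R : R) ^+ 5 by exact: exprn_ege1.
have an : 1 <= #|A|%:R * (n%:R : R) ^+ 5 by nra.
nra.
Qed.

Let Nd_ge4 : 4 <= N / delta.
Proof. by have /andP[d0 d1] := hd; rewrite ler_pdivlMr //; have := N_ge24; nra. Qed.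

Let L_ge1 : 1 <= L.
Proof. exact: one_le_ln. Qed.

Let c_gt0 : 0 < c.
Proof.
have [_ _ n1] := card_ge1; rewrite sqrtr_gt0 divr_gt0 //; first by have := L_ge1; lra.
lra.
Qed.

Let c_sqr : c ^+ 2 = L / n%:R.
Proof. by rewrite sqr_sqrtr // divr_ge0 //; have := L_ge1; lra. Qed.

Let expL : expR (- L) = delta / N.
Proof.
have Nd : 0 < N / delta by have := Nd_ge4; lra.
by rewrite expRN lnK ?posrE // invf_div.
Qed.

Lemma alpha_ge : 96 * Num.sqrt L <= alpha S A delta n.
Proof.
rewrite /alpha -/N -/L -[leLHS]mulr1; apply: ler_wpM2l; first exact: mulr_ge0.
by apply: log2_log2_ge1; have [_ _ n1] := card_ge1; lra.
Qed.

Let v s := h s - vmin h.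
Let lam1 := scale c (spnorm h).
(** Small enough for Bernstein, as [v^2] ranges within [(spnorm h + 1)^2], and such that [lam2]
    times the variance of [v^2] is at most half the variance of [v]. *)
Let lam2 := (8 * (spnorm h + 1) ^+ 2)^-1.
(** On the grid [2^k <= n], so [k < n], and values lie in [[0, n]]: the multiples [j / n] with
    [j <= n^2] suffice. *)
Let proxy s (k : 'I_n) (j : 'I_(n ^ 2 + 1)) (w : outcome S A n) :=
  absorbed_value r (1 - (2 ^+ k)^-1) s (Phat w) (j%:R / n%:R).

Definition good_event (w : outcome S A n) : Prop :=
  [/\ forall s a k j b,
        ~ deviates P L w s a (scale c (spnorm (proxy s k j w))) (proxy s k j w) b,
      forall s a b, ~ deviates P L w s a lam1 v b
    & forall s a b, ~ deviates P L w s a lam2 (fun y => v y ^+ 2) b].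

Lemma prob_good_event (E : outcome S A n -> Prop) :
  (forall w, good_event w -> E w) -> 1 - delta <= prob P E.
Proof.
have /card_gt0P[s0 _] := cS.
pose I : finType := ((bool * (S * A) * ('I_n * 'I_(n ^ 2 + 1))) + (bool * (S * A) * bool))%type.
pose bad (i : I) w := match i with
  | inl (b, (s, a), (k, j)) =>
      deviates P L w s a (scale c (spnorm (proxy s k j w))) (proxy s k j w) b
  | inr (b, (s, a), e) =>
      if e then deviates P L w s a lam1 v b
      else deviates P L w s a lam2 (fun y => v y ^+ 2) b
  end.
move=> goodE.
apply: (@le_trans _ _ (1 - #|I|%:R * expR (- L))); last first.
  apply: (prob_ge_union kP (bad := bad)) => [w nb|].
    apply: goodE; split=> [s a k j b|s a b|s a b].
    - exact: (nb (inl (b, (s, a), (k, j)))).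
    - exact: (nb (inr (b, (s, a), true))).
    - exact: (nb (inr (b, (s, a), false))).
  have h0 : 0 <= spnorm h by exact: spnorm_ge0.
  case=> [[[b [s a]] [k j]]|[[b [s a]] [|]]] /=.
  - have pfree : block_free (s, a) (proxy s k j) by exact: absorbed_value_block_free.
    apply: (prob_deviates L kP n_gt0) => [w w' ww'||w x y].
    + by rewrite (pfree w w' ww').
    + exact: pfree.
    + apply: scale_span; [exact: ltW|exact: spnorm_ge0|exact: diff_le_spnorm].
  - apply: (prob_deviates L kP n_gt0) => // w x y.
    apply: scale_span => //; first exact: ltW.
    by rewrite /v opprB addrA subrK; exact: diff_le_spnorm.
  - apply: (prob_deviates L kP n_gt0) => // w x y; rewrite /lam2.
    have p : 0 < 8 * (spnorm h + 1) ^+ 2 by rewrite mulr_gt0 // exprn_gt0 //; lra.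
    rewrite ler_pdivrMl //.
    have vx0 : 0 <= v x by rewrite subr_ge0; exact: vmin_le.
    have vx1 : v x <= spnorm h by rewrite lerBlDl; exact: le_vmin_spnorm.
    have : v x ^+ 2 <= (spnorm h + 1) ^+ 2 by apply: lerXn2r; rewrite ?nnegrE; lra.
    by have := sqr_ge0 (v y); lra.
rewrite lerD2l lerN2 expL mulrA ler_pdivrMr; last by have := N_ge24; lra.
rewrite mulrC ler_pM2l; last by case/andP: hd.
(* Signs, pairs, and for each pair [n (n^2 + 1)] proxies together with [v] and [v^2]; every event
   has probability at most [delta / N]. *)
have -> : #|I| = (2 * (#|S| * #|A|) * (n * (n ^ 2 + 1) + 2))%N.
  by rewrite /I card_sum !card_prod !card_bool !card_ord; ring.
have -> : N = (2 * (#|S| * #|A|) * (12 * n ^ 5))%:R by rewrite /N !natrM; ring.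
rewrite ler_nat leq_mul2l; apply/orP; right.
have n3 : (n ^ 3 <= n ^ 5)%N by rewrite leq_pexp2l.
have n1 : (n ^ 1 <= n ^ 5)%N by rewrite leq_pexp2l.
have n0 : (n ^ 0 <= n ^ 5)%N by rewrite leq_pexp2l.
have -> : (n * (n ^ 2 + 1) + 2 = n ^ 3 + n ^ 1 + 2 * n ^ 0)%N by rewrite expn0 expn1 expnS; ring.
lia.
Qed.

Lemma opt_disc_value_range (Q : S -> A -> S -> R) gamma s : is_kernel Q ->
  0 <= gamma < 1 -> 0 <= opt_disc_value Q r gamma s <= (1 - gamma)^-1.
Proof.
move=> kQ hg; have /andP[g0 g1] := hg; have /card_gt0P[a0 _] := cA.
have gp : 0 < 1 - gamma by lra.
apply/andP; split.
  apply: le_trans (disc_value_le_opt r kQ hg cA (det_policyP (fun=> a0)) s).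
  apply: (le_disc_value kQ hg (det_policyP (fun=> a0)) (W := fun=> 0)) => x.
  by rewrite rew_det step_det (avg_cst kQ) mulr0 addr0; case/andP: (hr x a0).
apply: (opt_disc_value_le kQ hg cA (W := fun=> (1 - gamma)^-1)) => x a.
rewrite (avg_cst kQ); have /andP[_ r1] := hr x a.
have : (1 - gamma) * (1 - gamma)^-1 = 1 by rewrite mulfV // lt0r_neq0.
lra.
Qed.

Lemma grid_index (gamma : R) : in_grid n gamma -> exists k : 'I_n,
  [/\ gamma = 1 - (2 ^+ k)^-1, (2 ^+ k : R) <= n%:R & 0 <= gamma < 1].
Proof.
case=> k [-> [_ kn]].
have kn' : (k < n)%N.
  by apply: (leq_trans (ltn_expl k (ltnSn 1))); rewrite -(ler_nat R) natrX.
exists (Ordinal kn'); split=> //=.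
have k1 : (1 : R) <= 2 ^+ k by apply: exprn_ege1; lra.
have : 0 < (2 ^+ k : R)^-1 by rewrite invr_gt0; lra.
have : (2 ^+ k : R)^-1 <= 1 by rewrite invf_le1 //; lra.
by move=> h1 h2; apply/andP; split; lra.
Qed.

Section OnGoodEvent.
Variable w : outcome S A n.
Hypothesis good : good_event w.

Let Q := Phat (R := R) w.
Let kQ : is_kernel Q. Proof. exact: Phat_kernel. Qed.
Let eps_n : [/\ 0 < (n%:R : R)^-1, (n%:R : R)^-1 <= c ^+ 2 & (n%:R : R)^-1 <= 1].
Proof.
have [_ _ n1] := card_ge1; have n0 : (0 : R) < n%:R by lra.
split; [by rewrite invr_gt0|rewrite c_sqr ler_pMl ?invr_gt0 //|by rewrite invf_le1].
Qed.

(** The proxy is the one with [j] the integer part of [n V s]. This [j] is random, but the good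
    event covers every [j]. *)
Lemma opt_value_deviation (gamma : R) s a : in_grid n gamma ->
  let V := opt_disc_value Q r gamma in
  let x := c * Num.sqrt (spnorm V + 1) in 16 * x <= 1 ->
  `|avg Q s a V - avg P s a V|
  <= 4 * (c / Num.sqrt (spnorm V + 1)) * variance P s a V + 8 * x.
Proof.
move=> /grid_index[k [gE kn hg]] V x x16; case: good => [goodV _ _].
have [e0 ec e1] := eps_n; have [_ _ n1] := card_ge1.
have n0 : (0 : R) < n%:R by lra.
have /andP[V0] := opt_disc_value_range s kQ hg; rewrite -/V => V1.
have gV : (1 - gamma)^-1 = 2 ^+ k by rewrite gE subKr invrK.
have /andP[j1 j2] : (Num.truncn (V s * n%:R))%:R <= V s * n%:R < (Num.truncn (V s * n%:R)).+1%:R.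
  by apply: truncn_itv; rewrite mulr_ge0.
set j := Num.truncn _ in j1 j2.
have jn : (j < n ^ 2 + 1)%N.
  rewrite addn1 ltnS -(ler_nat R) natrX expr2; apply: (le_trans j1).
  by rewrite ler_wpM2r //; apply: (le_trans V1); rewrite gV.
have := goodV s a k (Ordinal jn); rewrite /proxy /= -gE.
set F := absorbed_value _ _ _ _ _ => nd.
apply: (deviation_proxy s (F := F) (eps := n%:R^-1)) => //.
- by rewrite ec ltW.
- move=> y; apply: (le_trans (absorbed_value_near r s kQ hg cA _ _)); rewrite -/V.
  rewrite ler_norml; have jE : j%:R / n%:R * n%:R = j%:R :> R by rewrite mulfVK ?lt0r_neq0.
  have iE : n%:R^-1 * n%:R = 1 :> R by rewrite mulVf ?lt0r_neq0.
  rewrite -natr1 in j2.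
  by apply/andP; split; rewrite -(ler_pM2r n0) ?mulNr mulrBl jE iE; lra.
- move=> cF; apply: (deviation_scale_le kP n_gt0) => //; [exact: c_sqr|exact: (spnorm_ge0 s)].
Qed.

Section Solver.
Variables (gamma : R) (out : (S -> A) * (S -> R)).
Hypotheses (gridg : in_grid n gamma) (spec : solve_spec n Q r gamma out).
Let V := opt_disc_value Q r gamma.

(** The correction [2 (1 - gamma) / n] absorbs the solver error 1/n in the minimum, and [3 / n] its
    effect 2/n on the span. *)
Lemma Lhat_le : Lhat A delta n gamma out.2
  <= (1 - gamma) * vmin V - 96 * (c * Num.sqrt (spnorm V + 1)).
Proof.
have /card_gt0P[s0 _] := cS; have [k [_ _ /andP[g0 g1]]] := grid_index gridg.
have out2 z : `|out.2 z - V z| <= n%:R^-1 by case: spec.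
have [e0 ec e1] := eps_n.
have b0 : 0 <= spnorm V by exact: spnorm_ge0.
have near : vmin out.2 <= vmin V + n%:R^-1.
  have [z -> _] := vminP s0 V; have := out2 z; rewrite ler_norml => /andP[_ h2].
  by apply: (le_trans (vmin_le s0 out.2 z)); lra.
have sp : spnorm V <= spnorm out.2 + 2 * n%:R^-1.
  by apply: spnorm_near => // y; rewrite distrC.
rewrite /Lhat; have L0 : 0 <= L by have := L_ge1; lra.
have : 96 * (c * Num.sqrt (spnorm V + 1))
    <= alpha S A delta n * Num.sqrt ((spnorm out.2 + 3 / n%:R + 1) / n%:R).
  have -> : c * Num.sqrt (spnorm V + 1) = Num.sqrt L * Num.sqrt ((spnorm V + 1) / n%:R).
    rewrite /c -!sqrtrM //; last by rewrite mulr_ge0 // ltW.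
    by congr Num.sqrt; ring.
  rewrite mulrA; apply: ler_pM => //; first exact: alpha_ge.
  rewrite ler_sqrt; last by rewrite mulr_ge0 ?(ltW e0) //; lra.
  by rewrite ler_pM2r //; lra.
have := ler_wpM2l (_ : 0 <= 1 - gamma) near.
have ge : 0 <= (1 - gamma) / n%:R by rewrite mulr_ge0 ?(ltW e0) //; lra.
move=> /(_ ltac:(lra)); rewrite mulrDr -mulrA; lra.
Qed.

Lemma max_Lhat_le_gain s :
  Num.max (Lhat A delta n gamma out.2) 0 <= gain P r (det_policy out.1) s.
Proof.
have /card_gt0P[s0 _] := cS; have [k [_ _ hg]] := grid_index gridg.
have /andP[g0 g1] := hg; have [e0 ec e1] := eps_n.
have gain0 z : 0 <= gain P r (det_policy out.1) z.
  apply: (le_gain (W := fun=> 0) kP (det_policyP out.1)) => y.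
  by rewrite step_det rew_det (avg_cst kP) addr0 subr0; case/andP: (hr y (out.1 y)).
have b0 : 0 <= spnorm V by exact: spnorm_ge0.
have m0 : 0 <= vmin V.
  by apply: vmin_ge => // z; case/andP: (opt_disc_value_range z kQ hg).
have := Lhat_le; set x := c * Num.sqrt (spnorm V + 1) => LV.
have c0 := c_gt0.
have q1 : 1 <= Num.sqrt (spnorm V + 1) by rewrite -[leLHS]sqrtr1 ler_sqrt; lra.
have x0 : 0 <= x by apply: mulr_ge0; lra.
rewrite ge_max gain0 andbT; apply: (le_trans LV).
(* For large [x] the bound on the score is negative, since [(1 - gamma) * vmin V <= 1], while gains
   are nonnegative. *)
case: (leP (16 * x) 1) => [x16|x16]; last first.
  apply: le_trans (gain0 s); have : (1 - gamma) * vmin V <= 1.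
    rewrite -ler_pdivlMl ?subr_gt0 // mulr1; apply: (le_trans (vmin_le s0 V s0)).
    by case/andP: (opt_disc_value_range s0 kQ hg).
  lra.
have c1 : c <= 1 by rewrite /x in x16; nra.
have ex : n%:R^-1 <= x.
  by apply: (le_trans ec); rewrite expr2 /x ler_pM2l //; lra.
have sq : Num.sqrt (spnorm V + 1) ^+ 2 = spnorm V + 1 by rewrite sqr_sqrtr //; lra.
apply: (@le_trans _ _ ((1 - gamma) * vmin V - 49 * x)); first by lra.
apply: (gain_ge_empirical (Q := Q) (V := V) (b := spnorm V)
  (k := c / Num.sqrt (spnorm V + 1)) (eps := n%:R^-1) kP hg hr) => //.
- by move=> z; rewrite vmin_le //=; exact: le_vmin_spnorm.
(* Near-optimality of the policy gives [V <= V^d + 1/n]; expanding [V^d] by its Bellman equation and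
   using [V^d <= V] inside the average leaves a single error 1/n. *)
- move=> z; case: spec => /(_ z) s1 _; rewrite -lerBlDr; apply: (le_trans s1).
  rewrite (disc_value_bellman r kQ hg (det_policyP out.1)) rew_det step_det lerD2l.
  apply: ler_wpM2l => //; case: (avg_markov (out.1 z) kQ) => _ mon _; apply: mon => y.
  by apply: disc_value_le_opt => //; exact: det_policyP.
- by move=> z; exact: opt_value_deviation.
- by apply: divr_ge0; lra.
- by rewrite -[X in _ * X]sq expr2 mulrA mulfVK // lt0r_neq0 //; lra.
- by rewrite ltW.
Qed.

End Solver.

Section OptimalGain.
Variables (pi : S -> A -> R) (rho : R).
Hypotheses (hp : is_policy pi) (rho01 : 0 <= rho <= 1).
Hypothesis h_eq : forall s, rew_pi r pi s = rho + (h s - step P pi h s).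
Hypothesis h_opt : forall s a, r s a + avg P s a h <= rho + h s.

Let b := spnorm h.
Let x := c * Num.sqrt (b + 1).

Lemma opt_value_bounds gamma s : 0 <= gamma < 1 -> 4 * x <= 1 ->
  (rho - 21 * x) / (1 - gamma) - 2 * b <= opt_disc_value Q r gamma s
    <= (rho + 21 * x) / (1 - gamma) + 2 * b.
Proof.
move=> hg x4; have c0 := c_gt0; have b0 : 0 <= b by exact: (spnorm_ge0 s).
have q1 : 1 <= Num.sqrt (b + 1) by rewrite -[leLHS]sqrtr1 ler_sqrt; lra.
have q0 : Num.sqrt (b + 1) != 0 by rewrite lt0r_neq0 //; lra.
have sq : Num.sqrt (b + 1) * Num.sqrt (b + 1) = b + 1.
  by rewrite -expr2 sqr_sqrtr //; lra.
have x0 : 0 <= x by apply: mulr_ge0; lra.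
have v01 z : 0 <= v z <= b.
  by rewrite /v subr_ge0 lerBlDl (vmin_le s) (le_vmin_spnorm s).
case: good => _ good1 good2.
have lam0 : 0 <= c / Num.sqrt (b + 1) by apply: divr_ge0; lra.
have lamb : c / Num.sqrt (b + 1) * (b + 1) = x by rewrite -[X in _ * X]sq mulrA mulfVK.
have dev1 z a : `|avg Q z a v - avg P z a v|
    <= c / Num.sqrt (b + 1) * variance P z a v + x.
  by apply: (deviation_scale_le kP n_gt0) => //; [exact: c_sqr|rewrite -/x; lra].
(* The remainder [L / n / lam2] is [8 c^2 (b + 1)^2 = 8 x^2 (b + 1)], which fixes the [y] of the
   value bounds; then [lam y = x^3 <= x]. *)
have dev2 z a : `|avg Q z a (fun y => v y ^+ 2) - avg P z a (fun y => v y ^+ 2)|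
    <= 2^-1 * variance P z a v + 8 * x ^+ 2 * (b + 1).
  have p : 0 < 8 * (b + 1) ^+ 2 by rewrite mulr_gt0 // exprn_gt0 //; lra.
  apply: le_trans (deviation_le kP n_gt0 _ (good2 z a)) _; first by rewrite invr_gt0.
  apply: lerD.
    rewrite ler_pdivrMl //; apply: (le_trans (variance_sqr_le kP z a v01)).
    rewrite [leRHS]mulrA ler_wpM2r ?(variance_ge0 kP) //.
    have -> : 8 * (b + 1) ^+ 2 / 2 = 4 * (b + 1) ^+ 2 by field.
    by rewrite ler_pM2l //; apply: lerXn2r; rewrite ?nnegrE; lra.
  have xx : x ^+ 2 = c ^+ 2 * (b + 1) by rewrite exprMn [X in _ * X]expr2 sq.
  by rewrite invrK -c_sqr xx -/b le_eqVlt; apply/orP; left; apply/eqP; ring.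
have y0 : 0 <= x ^+ 2 * (b + 1) by rewrite mulr_ge0 ?sqr_ge0 //; lra.
have lamy : c / Num.sqrt (b + 1) * (x ^+ 2 * (b + 1)) <= x.
  by rewrite mulrCA lamb; nra.
have dev2' z a : `|avg Q z a (fun y => v y ^+ 2) - avg P z a (fun y => v y ^+ 2)|
    <= 2^-1 * variance P z a v + 8 * (x ^+ 2 * (b + 1)) by rewrite mulrA.
rewrite (opt_disc_value_lower kP kQ hg hr hp cA rho01 h_eq b0 v01 dev1 dev2' lam0 lamb x4 y0 lamy).
exact: (opt_disc_value_upper kP kQ hg hr cA rho01 h_opt b0 v01 dev1 dev2' lam0 lamb x4 y0 lamy).
Qed.

Lemma exists_Lhat_ge : let y := Num.sqrt ((b + 1) / n%:R) in
  alpha S A delta n ^+ 2 * y < 1 ->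
  exists2 gamma, in_grid n gamma & forall out, solve_spec n Q r gamma out ->
    rho - 2 * alpha S A delta n ^+ 2 * y <= Lhat A delta n gamma out.2.
Proof.
move=> y small; have /card_gt0P[s0 _] := cS.
have [_ _ n1] := card_ge1; have n0 : (0 : R) < n%:R by lra.
have b0 : 0 <= b by exact: spnorm_ge0.
have b1 : 0 < b + 1 by exact: ltr_pwDr.
have bn : 0 <= (b + 1) / n%:R by rewrite divr_ge0 ?ltW.
have sL1 : 1 <= Num.sqrt L.
  by rewrite -[leLHS]sqrtr1 ler_sqrt ?L_ge1 //; exact: le_trans L_ge1.
have L0 : 0 <= L by exact: le_trans L_ge1.
have := alpha_ge; set al := alpha S A delta n in small * => al1.
have y0 : 0 <= y by exact: sqrtr_ge0.
have xE : x = Num.sqrt L * y.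
  rewrite /x /y /c -!sqrtrM ?divr_ge0 ?(ltW n0) //.
  by congr Num.sqrt; ring.
have xal : 96 * x <= al * y by rewrite xE mulrA ler_wpM2r.
have al96 : 96 <= al by apply: le_trans al1; rewrite -[leLHS]mulr1 ler_pM2l.
have al0 : 0 <= al by exact: le_trans al96.
have aly : 96 * (al * y) <= al ^+ 2 * y.
  by rewrite expr2 -mulrA; apply: ler_wpM2r => //; exact: mulr_ge0.
have yal : 96 * y <= al * y by apply: ler_wpM2r.
have y1 : 2 * y <= 1 by move: small aly yal y0; lra.
have x4 : 4 * x <= 1 by move: small aly xal y0; lra.
(* The horizon balancing the discounting error [b / z] against [y]. It depends on the unknown [h],
   hence the search over the grid. The power of two above it is in the grid because [sqrt n <= z]
   and [2 z = 2 n y <= n]. *)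
pose z := Num.sqrt (n%:R * (b + 1)).
have yz : y * z = b + 1.
  rewrite /y /z -sqrtrM //.
  rewrite [X in Num.sqrt X](_ : _ = (b + 1) ^+ 2); last by field; exact: lt0r_neq0.
  by rewrite sqrtr_sqr gtr0_norm.
have zE : z = n%:R * y.
  rewrite /z /y [X in Num.sqrt X = _](_ : _ = n%:R ^+ 2 * ((b + 1) / n%:R)).
    by rewrite sqrtrM ?sqr_ge0 // sqrtr_sqr gtr0_norm.
  by field; exact: lt0r_neq0.
have z_sqrt : Num.sqrt n%:R <= z.
  rewrite /z ler_sqrt; last by rewrite mulr_ge0 ?ltW.
  by rewrite -[leLHS]mulr1 ler_pM2l // lerDr.
have z1 : 1 <= z.
  by apply: le_trans z_sqrt; rewrite -[leLHS]sqrtr1 ler_sqrt // ltW.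
have [k /andP[zk kz]] := exists_pow2 z1.
set H := 2 ^+ k in zk kz.
have zn : 2 * z <= n%:R by rewrite zE mulrCA -[leRHS]mulr1 ler_pM2l.
have gridg : in_grid n (1 - H^-1 : R).
  by exists k; split=> //; split; [exact: le_trans zk|exact: le_trans kz zn].
exists (1 - H^-1) => // out [_ out2].
have [k' [_ _ hg]] := grid_index gridg; set gamma := 1 - H^-1 in hg out2 *.
have H1 : 1 <= H by exact: le_trans zk.
have H0 : 0 < H by exact: lt_le_trans H1.
have gE : 1 - gamma = H^-1 by rewrite /gamma subKr.
have gH : H^-1 * H = 1 by rewrite mulVf // lt0r_neq0.
have g01 : 0 < H^-1 <= 1 by rewrite invr_gt0 H0 invf_le1.
pose V := opt_disc_value Q r gamma.
have Vb s : (rho - 21 * x) * H - 2 * b <= V s <= (rho + 21 * x) * H + 2 * b.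
  by have := opt_value_bounds s hg x4; rewrite gE invrK.
have {}out2 s : `|out.2 s - V s| <= n%:R^-1 by exact: out2.
have Vmin : (rho - 21 * x) * H - 2 * b <= vmin V.
  by apply: vmin_ge => // s; case/andP: (Vb s).
have outmin : vmin V - n%:R^-1 <= vmin out.2.
  apply: vmin_ge => // s; have := out2 s; rewrite ler_norml lerBrDl => /andP[h1 _].
  by apply: le_trans h1; rewrite lerD2r vmin_le.
have outsp : spnorm out.2 <= 42 * (x * H) + 4 * b + 2 * n%:R^-1.
  apply: (le_trans (spnorm_near s0 out2)); rewrite lerD2r.
  apply: (le_trans (spnorm_le s0 Vb)).
  by rewrite le_eqVlt; apply/orP; left; apply/eqP; ring.
have n_inv : 0 <= (n%:R : R)^-1 <= 1 by rewrite invr_ge0 (ltW n0) invf_le1.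
have ninvy : 0 <= (n%:R : R)^-1 <= y.
  by rewrite invr_ge0 (ltW n0) -div1r ler_pdivrMr // mulrC -zE.
have sp := score_radius_bound sL1 al1 xE y0 b0 yz kz n_inv outsp.
have rad : al * Num.sqrt ((spnorm out.2 + 3 / n%:R + 1) / n%:R) <= al ^+ 2 * y.
  rewrite expr2 -mulrA ler_wpM2l // -[X in X * y]ger0_norm //.
  rewrite -sqrtr_sqr /y -sqrtrM ?sqr_ge0 // ler_sqrt; last by rewrite mulr_ge0 ?sqr_ge0.
  by rewrite mulrA ler_wpM2r //; case/andP: n_inv.
have center := score_center_bound al96 xal y0 yz zk gH g01 ninvy Vmin outmin.
apply: (le_trans center); rewrite /Lhat gE -/al -[2 * H^-1 / _]mulrA.
by rewrite lerD2l lerN2.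
Qed.

End OptimalGain.
End OnGoodEvent.
End GoodEvent.

Theorem theorem1 (R : realType) :
  exists C3 : R,
  forall (S A : finType) (P : S -> A -> S -> R) (r : S -> A -> R)
         (delta : R) (n : nat)
         (solver : (S -> A -> S -> R) -> R -> (S -> A) * (S -> R))
         (ghat : outcome S A n -> R)
         (pistar : S -> A -> R),
    (0 < #|S|)%N -> (0 < #|A|)%N ->
    is_kernel P -> weakly_communicating P ->
    (forall s a, 0 <= r s a <= 1) ->
    0 < delta < 1 -> (0 < n)%N ->
    (* SolveDMDP meets its specification on every call *)
    (forall (w : outcome S A n) gamma, in_grid n gamma ->
       solve_spec n (Phat w) r gamma (solver (Phat w) gamma)) ->
    (* ghat w is an argmax of Lhat over the grid H *)
    (forall w : outcome S A n,
       in_grid n (ghat w) /\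
       forall gamma, in_grid n gamma ->
         Lhat A delta n gamma (solver (Phat w) gamma).2
         <= Lhat A delta n (ghat w) (solver (Phat w) (ghat w)).2) ->
    blackwell_optimal P r pistar ->
    prob P (fun w : outcome S A n =>
      let pihat := det_policy (solver (Phat w) (ghat w)).1 in
      let rhohat := Num.max (Lhat A delta n (ghat w) (solver (Phat w) (ghat w)).2) 0 in
      forall s : S,
        rhohat <= gain P r pihat s /\
        opt_gain P r s
          - C3 * alpha S A delta n ^+ 2
               * Num.sqrt ((spnorm (bias P r pistar) + 1) / n%:R)
          <= rhohat)
    >= 1 - delta.
Proof.
(* One [alpha^2 y] for the centre of the score and one for its radius. *)
exists 2 => S A P r delta n solver ghat pi cS cA kP wc hr hd n0 spec argmax bw.
have [rho [opt_rho h_eq h_opt]] :=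
  average_optimality_equation kP bw (fun s a => proj1 (andP (hr s a))) wc cS.
have /card_gt0P[s0 _] := cS; case: (bw) => hp _.
have rho01 : 0 <= rho <= 1.
  rewrite -(opt_rho s0) (blackwell_opt_gain kP bw); apply/andP; split.
    apply: (le_gain (W := fun=> 0) kP hp) => s; case: (step_markov kP hp) => _ _ ->.
    rewrite addr0 subr0; apply: policy_avg_ge => // a; by case/andP: (hr s a).
  by apply: gain_le => // s a; case/andP: (hr s a).
apply: (prob_good_event (r := r) (h := bias P r pi) cS cA kP hd n0) => w good pihat rhohat s.
have [gridg best] := argmax w.
split; first exact: (max_Lhat_le_gain cS cA kP hr hd n0 good gridg (spec w _ gridg)).
rewrite opt_rho; set y := Num.sqrt _.
(* In the second case the right-hand bound is negative, as [rho <= 1], and the truncation of the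
   estimate at 0 suffices. *)
case: (ltP (alpha S A delta n ^+ 2 * y) 1) => [small|big].
  have [gamma gridg' Lge] :=
    exists_Lhat_ge cS cA kP hr hd n0 good hp rho01 h_eq h_opt small.
  apply: le_trans (Lge _ (spec w _ gridg')) _; apply: le_trans (best _ gridg') _.
  by rewrite /rhohat le_max lexx.
rewrite /rhohat le_max; apply/orP; right.
by have /andP[_ rho1] := rho01; lra.
Qed.
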